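(* Let $\lambda>0$, $\sigma\in(0,1]$, $0<\gamma<\sigma/2$. Let $\varsigma\in(0,1)$, $0<\tau<(1-\varsigma)L_f^{-1}$, $0<\beta_{\max}\le\frac{\sqrt{\varsigma(\tau^{-1}-L_f)\tau^{-1}}}{2(\tau^{-1}+L_f)}$, $x^0\in\mathcal{S}$, $x^{-1}=x^0$, and let $\{x^k\}_{k\in\mathbb{N}}$ be any (infinite) sequence generated by $$\widetilde{x}^k=x^k+\beta_k(x^k-x^{k-1}),\qquad x^{k+1}\in\mathcal{P}_{\tau}g_{\lambda}\big(\widetilde{x}^k-\tau\nabla f_{\sigma,\gamma}(\widetilde{x}^k)\big),\qquad k=0,1,2,\ldots,$$ with arbitrary $\beta_k\in[0,\beta_{\max}]$. Then: (i) $\sum_{k=1}^{\infty}\|x^{k+1}-x^k\|<\infty$, and consequently $\{x^k\}_{k\in\mathbb{N}}$ converges to some $x^*\in S_{\tau,g_{\lambda}}$. (ii) If $F_{\sigma,\gamma}$ is a KL function of exponent $1/2$, then there exist $c_1>0$ and $\varrho\in(0,1)$ such that for all sufficiently large $k$, $\|x^k-x^*\|\le c_1\varrho^k$.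
   Context: $\mathcal{S}=\{x\in\mathbb{R}^n:\|x\|=1\}$; $\delta_{\mathcal{S}}$ is its indicator function ($0$ on $\mathcal{S}$, $+\infty$ elsewhere); $\|x\|_0$ is the number of nonzero entries of $x$. $A\in\mathbb{R}^{m\times n}$ is a given matrix ($A=\mathrm{Diag}(b)\Phi$ with $b\in\{-1,1\}^m$, $\Phi\in\mathbb{R}^{m\times n}$), and $f_{\sigma,\gamma}(x):=\sum_{i=1}^m\vartheta_{\sigma,\gamma}((Ax)_i)$, where $$\vartheta_{\sigma,\gamma}(t)=\begin{cases}0 & t>0,\\ t^2/(2\gamma) & -\gamma<t\le 0,\\ -t-\gamma/2 & -\sigma+\gamma<t\le-\gamma,\\ \sigma-\frac{\gamma}{2}-\frac{(t+\sigma+\gamma)^2}{4\gamma} & -(\sigma+\gamma)\le t\le\gamma-\sigma,\\ \sigma-\gamma/2 & t<-(\sigma+\gamma).\end{cases}$$ $f_{\sigma,\gamma}$ is continuously differentiable and $L_f$ denotes the Lipschitz constant of $\nabla f_{\sigma,\gamma}$ (with $L_f\le\gamma^{-1}\|A\|^2$). $g_{\lambda}(x):=\delta_{\mathcal{S}}(x)+\lambda\|x\|_0$ and $F_{\sigma,\gamma}(x):=f_{\sigma,\gamma}(x)+\delta_{\mathcal{S}}(x)+\lambda\|x\|_0$. For a proper lower semicontinuous $h$ and $\tau>0$, the (set-valued) proximal mapping is $\mathcal{P}_{\tau}h(x):=\arg\min_{z\in\mathbb{R}^n}\{\frac{1}{2\tau}\|z-x\|^2+h(z)\}$. $S_{\tau,g_{\lambda}}$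 is the set of $\tau$-stationary points: $x\in S_{\tau,g_{\lambda}}$ iff $x\in\mathcal{P}_{\tau}g_{\lambda}(x-\tau\nabla f_{\sigma,\gamma}(x))$. KL property: a proper lower semicontinuous $h:\mathbb{R}^n\to(-\infty,+\infty]$ has the KL property of exponent $\theta\in[0,1)$ at $\overline{x}\in\mathrm{dom}\,\partial h$ if there exist $\eta\in(0,+\infty]$, a neighborhood $\mathcal{U}$ of $\overline{x}$ and $c>0$ such that, with $\varphi(t)=ct^{1-\theta}$, $\varphi'(h(x)-h(\overline{x}))\,\mathrm{dist}(0,\partial h(x))\ge 1$ for all $x\in\mathcal{U}$ with $h(\overline{x})<h(x)<h(\overline{x})+\eta$. Here $\partial h$ is the limiting (Mordukhovich) subdifferential. $h$ is a KL function of exponent $\theta$ if this holds at every point of $\mathrm{dom}\,\partial h$. *)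

(* Defs.v *)
From mathcomp Require Export all_boot all_order all_algebra.
From mathcomp Require Export all_classical all_reals all_analysis.
Export Order.TTheory GRing.Theory Num.Theory.
Export numFieldNormedType.Exports.

Set Implicit Arguments.
Unset Strict Implicit.
Unset Printing Implicit Defensive.

Local Open Scope classical_set_scope.
Local Open Scope ring_scope.

(* The library norm [`|x|] on ['cV[R]_n] is the max norm; it is used below only
   through the topology it induces.  All metric quantities use [enorm]. *)
Definition dotv {R : realType} {n : nat} (x y : 'cV[R]_n) : R :=
  \sum_i x i 0 * y i 0.

Definition enorm {R : realType} {n : nat} (x : 'cV[R]_n) : R :=
  Num.sqrt (dotv x x).

Definition l0norm {R : realType} {n : nat} (x : 'cV[R]_n) : nat :=
  #|[pred i | x i 0 != 0]|.

Definition unit_sphere {R : realType} {n : nat} : set 'cV[R]_n :=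
  [set x | enorm x = 1].

(* Convex-analysis indicator (0 on [C], +oo off [C]), not the 0/1 [\1_C]. *)
Definition delta_set {R : realType} {T : Type} (C : set T) (x : T) : \bar R :=
  (if x \in C then 0 else +oo)%E.

Definition grad {R : realType} {n : nat} (f : 'cV[R]_n -> R) (x : 'cV[R]_n) :
    'cV[R]_n :=
  \col_i 'D_(delta_mx i 0) f x.

(* The smallest Lipschitz modulus with respect to the Euclidean norm; this
   reading is only meaningful when [G] is Lipschitz, since [inf set0 = 0]. *)
Definition lipschitz_const {R : realType} {n p : nat}
    (G : 'cV[R]_n -> 'cV[R]_p) : R :=
  inf [set L : R | 0 <= L /\
                   forall x y, enorm (G x - G y) <= L * enorm (x - y)].

Definition vartheta {R : realType} (sigma gamma t : R) : R :=
  if 0 < t then 0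
  else if - gamma < t then t ^+ 2 / (2 * gamma)
  else if - sigma + gamma < t then - t - gamma / 2
  else if - (sigma + gamma) <= t then
    sigma - gamma / 2 - (t + sigma + gamma) ^+ 2 / (4 * gamma)
  else sigma - gamma / 2.

Definition loss {R : realType} {m n : nat} (A : 'M[R]_(m, n))
    (sigma gamma : R) (x : 'cV[R]_n) : R :=
  \sum_(i < m) vartheta sigma gamma ((A *m x) i 0).

Definition reg {R : realType} {n : nat} (lambda : R) (x : 'cV[R]_n) : \bar R :=
  (delta_set (unit_sphere) x + (lambda * (l0norm x)%:R)%:E)%E.

Definition objective {R : realType} {m n : nat} (A : 'M[R]_(m, n))
    (lambda sigma gamma : R) (x : 'cV[R]_n) : \bar R :=
  ((loss A sigma gamma x)%:E + delta_set (unit_sphere) x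
   + (lambda * (l0norm x)%:R)%:E)%E.

Definition prox {R : realType} {n : nat} (tau : R) (h : 'cV[R]_n -> \bar R)
    (x : 'cV[R]_n) : set 'cV[R]_n :=
  let phi z := (((2 * tau)^-1 * enorm (z - x) ^+ 2)%:E + h z)%E in
  [set z | forall z', (phi z <= phi z')%E].

Definition tau_stationary {R : realType} {m n : nat} (A : 'M[R]_(m, n))
    (lambda sigma gamma tau : R) : set 'cV[R]_n :=
  [set x | prox tau (reg lambda) (x - tau *: grad (loss A sigma gamma) x) x].

(* Regular (Frechet) subdifferential:
   liminf_(z -> x, z <> x) (h z - h x - <v, z - x>) / |z - x| >= 0. *)
Definition regular_subdiff {R : realType} {n : nat} (h : 'cV[R]_n -> \bar R)
    (x : 'cV[R]_n) : set 'cV[R]_n :=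
  [set v | h x \is a fin_num /\
    (0 <= limf_einf (fun z => (h z - h x - (dotv v (z - x))%:E)
                              * ((enorm (z - x))^-1)%:E) x^')%E].

Definition limiting_subdiff {R : realType} {n : nat} (h : 'cV[R]_n -> \bar R)
    (x : 'cV[R]_n) : set 'cV[R]_n :=
  [set v | h x \is a fin_num /\
    exists (y w : nat -> 'cV[R]_n),
      [/\ y @ \oo --> x,
          (fun k => h (y k)) @ \oo --> h x,
          (forall k, regular_subdiff h (y k) (w k)) &
          w @ \oo --> v]].

Definition dom_subdiff {R : realType} {n : nat} (h : 'cV[R]_n -> \bar R) :
    set 'cV[R]_n :=
  [set x | limiting_subdiff h x !=set0].

(* [dist(0, C)], equal to +oo when [C] is empty. *)
Definition dist0 {R : realType} {n : nat} (C : set 'cV[R]_n) : \bar R :=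
  ereal_inf [set (enorm v)%:E | v in C].

(* Only [xbar] in [dom_subdiff h] is relevant, so that [h xbar] is finite. *)
Definition KL_at {R : realType} {n : nat} (h : 'cV[R]_n -> \bar R)
    (theta : R) (xbar : 'cV[R]_n) : Prop :=
  exists (eta : \bar R) (U : set 'cV[R]_n) (c : R),
    [/\ (0 < eta)%E, nbhs xbar U, 0 < c &
      let phi (t : R) := c * t `^ (1 - theta) in
      forall x, U x -> (h xbar < h x < h xbar + eta)%E ->
        (1 <= (derive1 phi (fine (h x - h xbar)))%:E
              * dist0 (limiting_subdiff h x))%E].

Definition KL_function {R : realType} {n : nat} (h : 'cV[R]_n -> \bar R)
    (theta : R) : Prop :=
  forall xbar, dom_subdiff h xbar -> KL_at h theta xbar.

(* Since [0.-1 = 0], the term [x k.-1] encodes the convention x^(-1) = x^0. *)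
Definition extrapolation {R : realType} {n : nat} (beta : nat -> R)
    (x : nat -> 'cV[R]_n) (k : nat) : 'cV[R]_n :=
  x k + beta k *: (x k - x k.-1).

(* Main.v *)
From mathcomp Require Import ring lra.
Require Import Defs.
Set Implicit Arguments.
Unset Strict Implicit.
Unset Printing Implicit Defensive.
Local Open Scope classical_set_scope.
Local Open Scope ring_scope.

(** The argument has a descent part, which is elementary, and a geometric part,
    which explains why summability needs no Kurdyka-Lojasiewicz hypothesis.

    Descent.  Comparing [x k.+1] with [x k] in the proximal problem and applying
    the descent lemma at the extrapolated point shows that
    [f + lambda |.|_0 + a |x k - x k.-1|^2] decreases at each step by a multiple
    of the squares of the last two gaps; the bound on [beta_max] is what leaves
    room for this ([descent], [H_decrease]).  Since the proximal problem lives on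
    the sphere, its objective is affine there apart from the counting term
    ([prox_regP]).  Deleting a small entry would save [lambda] at almost no cost,
    so nonzero entries of the iterates stay away from zero ([prox_entries]) and
    the support is eventually constant; along the support the argument of
    the proximal step is normal to the sphere at [x k.+1] ([prox_normal]), which
    bounds the tangential gradient there by the last two gaps ([residual]).

    Geometry.  On a fixed support the problem is to minimize a [C^1] piecewise
    quadratic function on the sphere.  The key fact is that a quadratic function
    on the sphere satisfies, near each critical point, a Lojasiewicz inequality
    of exponent 3/4: the cube of the variation of the value is bounded by the
    fourth power of the tangential gradient ([quadratic_lojasiewicz]).  The loss
    is a combination of squared hinges, near a given point only finitely many
    quadratic pieces occur, and the function and its gradient agree with the
    piece at both points compared, so the inequality passes to the loss
    ([hinge_lojasiewicz_critical]); compactness of the sphere makes it uniform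
    ([hinge_lojasiewicz]).  The usual concavity argument then sums the gaps
    ([finite_length]), and the limit is stationary because the variational
    inequalities of the proximal steps pass to the limit once the support is
    constant ([limit_stationary]).

    Rate.  At a point of the sphere, the tangential gradient along the support is
    a subgradient of the objective ([tangent_regular_subgradient]); an exponent
    1/2 therefore bounds the excess of the objective by the squares of the gaps,
    that is by a multiple of its own decrease, whence geometric convergence
    ([geometric_decay], [linear_rate]). *)

(** * Euclidean geometry *)

Section Euclid.
Context {R : realType} {n : nat}.
Implicit Types (x y z u v : 'cV[R]_n) (a c : R).

Lemma dotvE x y : dotv x y = (x^T *m y) 0 0.
Proof. by rewrite mxE; apply: eq_bigr => i _; rewrite mxE. Qed.

Lemma dotvC x y : dotv x y = dotv y x.
Proof. by apply: eq_bigr => i _; rewrite mulrC. Qed.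

Lemma dotvDl x y z : dotv (x + y) z = dotv x z + dotv y z.
Proof. by rewrite -big_split; apply: eq_bigr => i _; rewrite mxE mulrDl. Qed.

Lemma dotvZl a x y : dotv (a *: x) y = a * dotv x y.
Proof. by rewrite mulr_sumr; apply: eq_bigr => i _; rewrite mxE mulrA. Qed.

Lemma dotvNl x y : dotv (- x) y = - dotv x y.
Proof. by rewrite -scaleN1r dotvZl mulN1r. Qed.

Lemma dotvBl x y z : dotv (x - y) z = dotv x z - dotv y z.
Proof. by rewrite dotvDl dotvNl. Qed.

Lemma dotvDr x y z : dotv z (x + y) = dotv z x + dotv z y.
Proof. by rewrite !(dotvC z) dotvDl. Qed.

Lemma dotvZr a x y : dotv y (a *: x) = a * dotv y x.
Proof. by rewrite !(dotvC y) dotvZl. Qed.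

Lemma dotvNr x y : dotv y (- x) = - dotv y x.
Proof. by rewrite !(dotvC y) dotvNl. Qed.

Lemma dotvBr x y z : dotv z (x - y) = dotv z x - dotv z y.
Proof. by rewrite dotvDr dotvNr. Qed.

Lemma dot0v x : dotv 0 x = 0.
Proof. by rewrite -(scale0r 0) dotvZl mul0r. Qed.

Lemma dotv0 x : dotv x 0 = 0.
Proof. by rewrite dotvC dot0v. Qed.

Lemma dotv_suml {I : finType} (F : I -> 'cV[R]_n) y :
  dotv (\sum_i F i) y = \sum_i dotv (F i) y.
Proof.
by elim/big_rec2: _ => [|i a b _ <-]; rewrite ?dot0v// dotvDl.
Qed.

Definition dotv_lin := (dotvDl, dotvBl, dotvZl, dotvNl, dotvDr, dotvBr,
  dotvZr, dotvNr, dot0v, dotv0).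

Lemma dotvv_ge0 x : 0 <= dotv x x.
Proof. by apply: sumr_ge0 => i _; rewrite -expr2 sqr_ge0. Qed.

Lemma dotvv_eq0 x : (dotv x x == 0) = (x == 0).
Proof.
apply/idP/eqP => [|->]; last by rewrite dot0v.
rewrite psumr_eq0; last by move=> i _; rewrite -expr2 sqr_ge0.
move=> /allP h; apply/colP => i; rewrite mxE.
by have := h i (mem_index_enum _); rewrite -expr2 sqrf_eq0 => /eqP.
Qed.

Lemma enorm_ge0 x : 0 <= enorm x.
Proof. exact: sqrtr_ge0. Qed.

Lemma sqr_enorm x : enorm x ^+ 2 = dotv x x.
Proof. by rewrite sqr_sqrtr// dotvv_ge0. Qed.

Lemma enorm_eq0 x : (enorm x == 0) = (x == 0).
Proof. by rewrite -(sqrf_eq0 (enorm x)) sqr_enorm dotvv_eq0. Qed.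

Lemma enorm0 : enorm (0 : 'cV[R]_n) = 0.
Proof. by apply/eqP; rewrite enorm_eq0. Qed.

Lemma enorm_gt0 x : (0 < enorm x) = (x != 0).
Proof. by rewrite lt_def enorm_eq0 enorm_ge0 andbT. Qed.

Lemma enormZ a x : enorm (a *: x) = `|a| * enorm x.
Proof.
by rewrite /enorm dotvZl dotvZr mulrA -expr2 sqrtrM ?sqr_ge0// sqrtr_sqr.
Qed.

Lemma enormN x : enorm (- x) = enorm x.
Proof. by rewrite -scaleN1r enormZ normrN1 mul1r. Qed.

Lemma enormB x y : enorm (x - y) = enorm (y - x).
Proof. by rewrite -enormN opprB. Qed.

Lemma sqr_enormD x y : enorm (x + y) ^+ 2 = enorm x ^+ 2 + 2 * dotv x y + enorm y ^+ 2.
Proof. by rewrite !sqr_enorm !dotv_lin (dotvC y x); ring. Qed.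

Lemma sqr_enormB x y : enorm (x - y) ^+ 2 = enorm x ^+ 2 - 2 * dotv x y + enorm y ^+ 2.
Proof. by rewrite !sqr_enorm !dotv_lin (dotvC y x); ring. Qed.

Lemma cauchy_schwarz x y : `|dotv x y| <= enorm x * enorm y.
Proof.
have [->|y0] := eqVneq y 0; first by rewrite dotv0 normr0 enorm0 mulr0.
have Y0 : 0 < enorm y by rewrite enorm_gt0.
have := dotvv_ge0 ((enorm y ^+ 2) *: x - (dotv x y) *: y).
rewrite !dotv_lin (dotvC y x) -!sqr_enorm => h.
rewrite -(@ler_pXn2r _ 2) ?nnegrE ?mulr_ge0 ?enorm_ge0// -normrX ger0_norm ?sqr_ge0//.
rewrite -(ler_pM2l (exprn_gt0 2 Y0)) -subr_ge0.
by apply: le_trans h _; rewrite le_eqVlt; apply/orP; left; apply/eqP; ring.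
Qed.

Lemma dotv_le x y : dotv x y <= enorm x * enorm y.
Proof. exact: le_trans (ler_norm _) (cauchy_schwarz _ _). Qed.

Lemma enorm_triangle x y : enorm (x + y) <= enorm x + enorm y.
Proof.
rewrite -(@ler_pXn2r _ 2) ?nnegrE ?addr_ge0 ?enorm_ge0// sqr_enormD.
by have := dotv_le x y; nra.
Qed.

Lemma enorm_triangleB x y : enorm (x - y) <= enorm x + enorm y.
Proof. by rewrite -(enormN y) enorm_triangle. Qed.

Lemma enorm_rev_triangle x y : `|enorm x - enorm y| <= enorm (x - y).
Proof.
rewrite ler_norml; apply/andP; split.
- have := enorm_triangle (y - x) x; rewrite subrK (enormB y) => h; lra.
- have := enorm_triangle (x - y) y; rewrite subrK => h; lra.
Qed.

Lemma enorm_sum {I : finType} (F : I -> 'cV[R]_n) :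
  enorm (\sum_i F i) <= \sum_i enorm (F i).
Proof.
elim/big_rec2: _ => [|i a b _ h]; first by rewrite enorm0.
by apply: le_trans (enorm_triangle _ _) _; rewrite lerD2l.
Qed.

Lemma coord_le_enorm x i : `|x i 0| <= enorm x.
Proof.
rewrite -(@ler_pXn2r _ 2) ?nnegrE ?enorm_ge0// sqr_enorm -normrX ger0_norm ?sqr_ge0//.
rewrite /dotv (bigD1 i)//= -expr2 lerDl.
by apply: sumr_ge0 => j _; rewrite -expr2 sqr_ge0.
Qed.

Lemma enorm_le_sum x : enorm x <= \sum_i `|x i 0|.
Proof.
rewrite -(@ler_pXn2r _ 2) ?nnegrE ?enorm_ge0 ?sumr_ge0// sqr_enorm.
rewrite expr2 mulr_suml; apply: ler_sum => i _.
rewrite -expr2 -[x i 0 ^+ 2]ger0_norm ?sqr_ge0// normrX expr2.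
apply: ler_wpM2l => //; rewrite (bigD1 i)//= lerDl.
by apply: sumr_ge0.
Qed.

Lemma dotv_delta x i : dotv x (delta_mx i 0) = x i 0.
Proof.
rewrite /dotv (bigD1 i)//= mxE !eqxx mulr1 big1 ?addr0// => j ji.
by rewrite mxE (negPf ji) mulr0.
Qed.

Lemma enorm_delta i : enorm (delta_mx i 0 : 'cV[R]_n) = 1.
Proof. by rewrite /enorm dotv_delta mxE !eqxx sqrtr1. Qed.

End Euclid.

Lemma dotv_mulmx {R : realType} {m n : nat} (M : 'M[R]_(m, n)) (x : 'cV_n) (y : 'cV_m) :
  dotv (M *m x) y = dotv x (M^T *m y).
Proof. by rewrite !dotvE trmx_mul mulmxA. Qed.

Lemma mulmx_bounded {R : realType} {m n : nat} (M : 'M[R]_(m, n)) :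
  exists2 C, 0 <= C & forall x : 'cV_n, enorm (M *m x) <= C * enorm x.
Proof.
exists (\sum_j enorm (col j M)); first by apply: sumr_ge0 => j _; exact: enorm_ge0.
move=> x.
have -> : M *m x = \sum_j x j 0 *: col j M.
  apply/colP => i; rewrite mxE summxE; apply: eq_bigr => j _.
  by rewrite !mxE mulrC.
apply: le_trans (enorm_sum _) _; rewrite mulr_suml; apply: ler_sum => j _.
by rewrite enormZ mulrC ler_wpM2l ?enorm_ge0// coord_le_enorm.
Qed.

(** * The Euclidean norm and the topology of column vectors *)

Section Topology.
Context {R : realType} {n : nat}.
Implicit Types (x y : 'cV[R]_n).

Lemma mxnorm_le_enorm x : `|x| <= enorm x.
Proof.
rewrite [leLHS]/Num.norm /= mx_normrE; apply/bigmax_leP; split => [|[i j] _ /=].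
  exact: enorm_ge0.
by rewrite (ord1 j) coord_le_enorm.
Qed.

Lemma enorm_le_mxnorm x : enorm x <= n%:R * `|x|.
Proof.
apply: le_trans (enorm_le_sum _) _.
rewrite mulr_natl -[X in _ <= _ *+ X]card_ord -sumr_const.
apply: ler_sum => i _; rewrite [leRHS]/Num.norm /= mx_normrE.
by apply/bigmax_geP; right; exists (i, 0).
Qed.

Lemma nbhs_enormP x (U : set 'cV[R]_n) :
  nbhs x U <-> exists2 e, 0 < e & forall y, enorm (y - x) < e -> U y.
Proof.
split => [/nbhs_ballP[e /= e0 h]|[e e0 h]].
- exists e => // y yx; apply: h; rewrite -ball_normE /=.
  by apply: le_lt_trans (mxnorm_le_enorm _) _; rewrite enormB.
- have n0 : 0 < n%:R + 1 :> R by rewrite ltr_wpDl.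
  apply/nbhs_ballP; exists (e / (n%:R + 1)) => /=; first by rewrite divr_gt0.
  move=> y; rewrite -ball_normE /= ltr_pdivlMr// => yx; apply: h.
  rewrite enormB; apply: le_lt_trans (enorm_le_mxnorm _) _.
  by apply: le_lt_trans _ yx; rewrite mulrC ler_wpM2l// lerDl.
Qed.

Lemma cvg_enormP (u : nat -> 'cV[R]_n) x :
  (u @ \oo --> x) <-> ((fun k => enorm (u k - x)) @ \oo --> (0 : R)).
Proof.
split => [h|h].
- apply/cvgrPdist_lt => e e0; near=> k.
  rewrite sub0r normrN ger0_norm ?enorm_ge0//.
  near: k; apply: (h [set y | enorm (y - x) < e]).
  by apply/nbhs_enormP; exists e.
- move=> U /nbhs_enormP[e e0 hU]; have /cvgrPdist_lt/(_ e e0) := h.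
  apply: filterS => k; rewrite sub0r normrN ger0_norm ?enorm_ge0//.
  exact: hU.
Unshelve. all: by end_near. Qed.

Lemma enorm_continuous : continuous (@enorm R n).
Proof.
move=> x U /nbhs_ballP[e /= e0 hU]; apply/nbhs_enormP; exists e => // y yx.
apply: hU; rewrite -ball_normE /= distrC.
exact: le_lt_trans (enorm_rev_triangle _ _) yx.
Qed.

Lemma compact_unit_sphere : compact (@unit_sphere R n).
Proof.
pose K := [set v : 'rV[R]_n | enorm v^T = 1].
have trc : continuous (fun v : 'rV[R]_n => v^T).
  move=> v U /nbhs_ballP[e /= e0 hU]; apply/nbhs_ballP; exists e => // w [_ vw].
  by apply: hU; split=> // i j; rewrite !mxE; exact: vw.
have cK : compact K.
  apply: bounded_closed_compact.
    exists 1; split; first exact: real1.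
    move=> M M1 v /= vK; apply: (@le_trans _ _ 1); last exact: ltW.
    rewrite -vK [leLHS]/Num.norm /= mx_normrE; apply/bigmax_leP; split.
      exact: enorm_ge0.
    by move=> [i j] _ /=; rewrite (ord1 i); have := coord_le_enorm v^T j; rewrite !mxE.
  apply: (@closed_comp _ _ (fun v : 'rV[R]_n => enorm v^T) [set 1]).
    move=> v _; apply: continuous_comp; first exact: trc.
    exact: enorm_continuous.
  exact: closed_eq.
have -> : unit_sphere = (fun v : 'rV[R]_n => v^T) @` K.
  apply/seteqP; split => [x x1|_ [v vK <-] //].
  by exists x^T; rewrite /K /= trmxK.
apply: continuous_compact => //; exact: continuous_subspaceT.
Qed.

(** Compactness of the sphere in the form used below: [K] plays at once the
    role of a constant and of the inverse of a radius, so that a single number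
    has to be made uniform. *)
Lemma unit_sphere_uniform (P : R -> 'cV[R]_n -> Prop) :
  (forall K K' x, K <= K' -> P K x -> P K' x) ->
  (forall xb, enorm xb = 1 -> exists2 K, 0 < K &
     forall x, enorm x = 1 -> K * enorm (x - xb) <= 1 -> P K x) ->
  exists2 K, 0 < K & forall x, enorm x = 1 -> P K x.
Proof.
move=> mono loc.
have /compact_near_coveringP/near_covering_withinP cov := compact_unit_sphere.
have : \forall K \near +oo, unit_sphere `<=` P K.
  apply: cov => xb xb1; have [K K0 hK] := loc _ xb1.
  exists ([set y | enorm (y - xb) < K^-1], [set K' | K <= K']).
    split; last by apply: nbhs_pinfty_ge; exact: num_real.
    by apply/nbhs_enormP; exists K^-1; rewrite ?invr_gt0.
  move=> [y K'] [/= yx KK'] y1; apply: mono KK' _; apply: hK => //.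
  by rewrite mulrC -ler_pdivlMr// mul1r ltW.
move=> h.
have : \forall K \near +oo, 0 < K /\ unit_sphere `<=` P K.
  near=> K; split; last by near: K.
  by near: K; apply: nbhs_pinfty_gt; exact: num_real.
by move=> /filter_ex[K [K0 hK]]; exists K.
Unshelve. all: by end_near. Qed.

End Topology.

(** * Lojasiewicz inequality for quadratic forms on the sphere *)

(** The scalar core of the case where the critical point [xb] equals [M w].  For
    [u = x - xb], the numbers are [nu = |u|], [s = <x, M u>], the norm [rho] of
    the tangential part [r] of [M u], and, with [G] a generalized inverse of [M]
    and [z = u - G M u] in the kernel of [M], [a = <G r, u>], [b = <G u, u>],
    [d = <w, u>], [t = <z, r>], [e = <w, r>], [om = <w, xb>].  The first relation
    expresses that [M u] is orthogonal to [z]; the second one is the sphere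
    constraint [<xb, u> = - nu^2 / 2].  Together they forbid [rho] to be small
    unless [s * nu] and [nu^3] are. *)
Lemma radial_estimate {R : realType} (om C g W : R) : 0 <= C -> 0 <= g -> 0 <= W ->
  exists2 K, 0 < K & forall s nu rho a b d t e : R,
    0 <= nu -> 0 <= rho -> `|s| <= C * nu ->
    `|a| <= g * rho * nu -> `|b| <= g * nu ^+ 2 -> `|d| <= W * nu ->
    `|t| <= (1 + g * C) * nu * rho -> `|e| <= W * rho ->
    s * (nu ^+ 2 - a - s * d - s * b) = - t ->
    nu ^+ 2 / 2 + s * om + e + s * d = 0 ->
    K * nu <= 1 -> `|s| * nu <= K * rho /\ nu ^+ 3 <= K * rho.
Proof.
move=> C0 g0 W0.
pose Z := 1 + g * C; have Z0 : 0 <= Z by rewrite addr_ge0// mulr_ge0.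
(* the bound on [nu^3] follows from the one on [s * nu] by the second relation *)
suff [K [K1 [K10 Kp hK]]] : exists K K1, [/\ 0 < K1, 0 < K & forall s nu rho a b d t e : R,
    0 < nu -> nu <= 1 -> 0 <= rho -> `|s| <= C * nu ->
    `|a| <= g * rho * nu -> `|b| <= g * nu ^+ 2 -> `|d| <= W * nu ->
    `|t| <= Z * nu * rho -> `|e| <= W * rho ->
    s * (nu ^+ 2 - a - s * d - s * b) = - t ->
    nu ^+ 2 / 2 + s * om + e + s * d = 0 ->
    K1 * nu <= 1 -> `|s| * nu <= K * rho].
  pose L := 2 * (`|om| * K + W + W * K).
  have L0 : 0 <= L by have := ltW Kp; rewrite /L; have := normr_ge0 om; nra.
  pose Q := 1 + K + K1 + L.
  have [Q0 Q1 QK QK1 QL] : [/\ 0 < Q, 1 <= Q, K <= Q, K1 <= Q & L <= Q].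
    by rewrite /Q; split; lra.
  exists Q => // s nu rho a b d t e; rewrite le_eqVlt => /predU1P[<-|nu0].
    by move=> p0 *; rewrite mulr0 expr0n /= mulr_ge0// ltW.
  move=> p0 hs ha hb hd ht he e1 e2 small.
  have below c : c <= Q -> c * nu <= 1.
    by move=> cQ; apply: le_trans small; rewrite ler_wpM2r// ltW.
  have nu1 : nu <= 1 by rewrite -[leLHS]mul1r below.
  have snu := hK _ _ _ _ _ _ _ _ nu0 nu1 p0 hs ha hb hd ht he e1 e2 (below _ QK1).
  split; first by apply: le_trans snu _; rewrite ler_wpM2r.
  have : nu ^+ 2 / 2 <= `|s| * `|om| + W * rho + `|s| * (W * nu).
    have h1 : - (s * om) <= `|s| * `|om| by rewrite -normrM -normrN ler_norm.
    have h2 : - (s * d) <= `|s| * (W * nu).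
      apply: (@le_trans _ _ (`|s| * `|d|)); first by rewrite -normrM -normrN ler_norm.
      by rewrite ler_wpM2l.
    have h3 : - e <= W * rho by apply: le_trans he; rewrite -normrN ler_norm.
    clear hs ha hb hd ht he e1 snu; lra.
  clear ha hb hd ht he e1 e2 => /(ler_wpM2r (ltW nu0)) h.
  have h1 : `|s| * `|om| * nu <= `|om| * (K * rho) by rewrite mulrAC mulrC ler_wpM2l.
  have h2 : `|s| * (W * nu) * nu <= W * (K * rho).
    rewrite mulrCA -mulrA ler_wpM2l//; apply: le_trans snu.
    by rewrite -mulrA ler_wpM2l// ler_piMr// ltW.
  have h3 : W * rho * nu <= W * rho by rewrite ler_piMr// mulr_ge0.
  have : nu ^+ 3 <= L * rho.
    have -> : nu ^+ 3 = 2 * (nu ^+ 2 / 2 * nu) by field.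
    by rewrite /L; nra.
  by move=> /le_trans; apply; rewrite ler_wpM2r.
have main s nu rho a b d t : 0 < nu -> nu <= 1 -> 0 <= rho -> `|s| <= C * nu ->
    `|a| <= g * rho * nu -> `|b| <= g * nu ^+ 2 -> `|t| <= Z * nu * rho ->
    s * (nu ^+ 2 - a - s * d - s * b) = - t ->
    `|s| * (nu ^+ 2 - s * d) <= (Z + C * g) * nu * rho + `|s| ^+ 2 * (g * nu ^+ 2).
  move=> nu0 nu1 p0 hs ha hb ht e1.
  have {}e1 : s * (nu ^+ 2 - s * d) = s * a + s * (s * b) - t by lra.
  apply: (@le_trans _ _ `|s * (nu ^+ 2 - s * d)|).
    by rewrite normrM ler_wpM2l// ler_norm.
  rewrite e1; apply: le_trans (ler_normB _ _) _.
  have := ler_normD (s * a) (s * (s * b)).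
  have h1 : `|s * a| <= C * g * nu * rho.
    rewrite normrM; apply: (@le_trans _ _ ((C * nu) * (g * rho * nu))).
      by apply: ler_pM.
    have -> : C * nu * (g * rho * nu) = (C * g * nu * rho) * nu by ring.
    by rewrite ler_piMr// !mulr_ge0// ltW.
  have h2 : `|s * (s * b)| <= `|s| ^+ 2 * (g * nu ^+ 2).
    by rewrite mulrA normrM normrM -expr2 ler_wpM2l// exprn_ge0.
  lra.
have [om0|om0] := eqVneq om 0.
- (* [om = 0]: the second relation gives [- s d = nu^2 / 2 + e], so that the
     two contributions of order [s nu^2] in the first one do not cancel *)
  exists (Z + C * g + C * W), (1 + 2 * (g * C)); split.
  + by have := mulr_ge0 g0 C0; lra.
  + by have := mulr_ge0 g0 C0; have := mulr_ge0 C0 W0; rewrite /Z; nra.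
  move=> s nu rho a b d t e nu0 nu1 p0 hs ha hb hd ht he e1 e2 small.
  have := main _ _ _ _ _ _ _ nu0 nu1 p0 hs ha hb ht e1.
  have -> : nu ^+ 2 - s * d = 3 / 2 * nu ^+ 2 + e.
    by move: e2; rewrite om0 mulr0; lra.
  move=> h.
  have h1 : - (`|s| * e) <= C * W * nu * rho.
    apply: (@le_trans _ _ (`|s| * `|e|)).
      by rewrite -mulrN ler_wpM2l// -normrN ler_norm.
    have -> : C * W * nu * rho = (C * nu) * (W * rho) by ring.
    exact: ler_pM.
  have h2 : `|s| ^+ 2 * (g * nu ^+ 2) <= `|s| * nu ^+ 2 / 2.
    have -> : `|s| ^+ 2 * (g * nu ^+ 2) = `|s| * nu ^+ 2 * (g * `|s|) by ring.
    rewrite -mulrA -[leRHS]mulrA ler_wpM2l// ler_wpM2l ?sqr_ge0//.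
    have := ler_wpM2l g0 hs; nra.
  rewrite -(ler_pM2r nu0); clear ha hb hd ht he e1 e2; nra.
- (* [om <> 0]: the second relation makes [s] of order [nu^2 + rho], and [s d] is
     negligible in the first one *)
  have o0 : 0 < `|om| by rewrite normr_gt0.
  pose k := (1 + W) * 2 / `|om|; have k0 : 0 <= k by rewrite divr_ge0 ?mulr_ge0//; lra.
  exists (1 + 2 * (Z + C * g + (W + g) * k * C)), (1 + 2 * W / `|om| + 2 * ((W + g) * k)).
  have A0 : 0 <= W / `|om| by rewrite divr_ge0.
  have A1 : 0 <= (W + g) * k by rewrite mulr_ge0// addr_ge0.
  split.
  + lra.
  + by have := mulr_ge0 A1 C0; have := mulr_ge0 C0 g0; lra.
  move=> s nu rho a b d t e nu0 nu1 p0 hs ha hb hd ht he e1 e2 small.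
  have := main _ _ _ _ _ _ _ nu0 nu1 p0 hs ha hb ht e1.
  have S0 := normr_ge0 s.
  have sd : `|s * d| <= `|s| * (W * nu) by rewrite normrM ler_wpM2l.
  have Wnu : W * nu <= `|om| / 2.
    have -> : W = W / `|om| * `|om| by rewrite divfK// normr_eq0.
    rewrite mulrAC; set q := W / `|om| in A0 small *.
    have q1 : q * nu <= 2^-1 by have := mulr_ge0 A1 (ltW nu0); rewrite /q; lra.
    by have := ler_wpM2r (ltW o0) q1; lra.
  have sk : `|s| <= k * (nu ^+ 2 + rho).
    have : `|s * om| <= nu ^+ 2 / 2 + W * rho + `|s| * (W * nu).
      have -> : s * om = - (nu ^+ 2 / 2) - e - s * d by lra.
      apply: le_trans (ler_normB _ _) _; apply: lerD => //.
      apply: le_trans (ler_normB _ _) _; apply: lerD => //.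
      by rewrite normrN ger0_norm// divr_ge0// sqr_ge0.
    rewrite normrM => h; rewrite /k -2!mulrA (mulrC _^-1) !mulrA ler_pdivlMr//.
    have := ler_wpM2l S0 Wnu; have := sqr_ge0 nu; have := mulr_ge0 W0 (sqr_ge0 nu).
    clear ha hb ht; nra.
  move=> h; clear ha hb hd ht he e1 e2.
  have h1 : `|s| ^+ 2 <= `|s| * nu * (k * nu) + C * nu * k * rho.
    apply: (@le_trans _ _ (`|s| * (k * (nu ^+ 2 + rho)))).
      by rewrite expr2 ler_wpM2l.
    have -> : `|s| * (k * (nu ^+ 2 + rho)) = `|s| * nu * (k * nu) + `|s| * (k * rho) by ring.
    by rewrite lerD2l -(mulrA (C * nu)) ler_wpM2r// mulr_ge0.
  have h2 : `|s| * nu ^+ 2 <= (Z + C * g) * nu * rho + `|s| ^+ 2 * ((W + g) * nu).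
    have l1 : `|s| * (s * d) <= `|s| ^+ 2 * (W * nu).
      by rewrite expr2 -mulrA ler_wpM2l//; apply: le_trans sd; exact: ler_norm.
    have l2 : `|s| ^+ 2 * (g * nu ^+ 2) <= `|s| ^+ 2 * (g * nu).
      by rewrite ler_wpM2l ?sqr_ge0// ler_wpM2l// expr2 ler_piMr// ltW.
    lra.
  have h3 : `|s| * nu <= (Z + C * g) * rho + `|s| ^+ 2 * (W + g).
    rewrite -(ler_pM2r nu0).
    have -> : `|s| * nu * nu = `|s| * nu ^+ 2 by ring.
    apply: le_trans h2 _; rewrite le_eqVlt; apply/orP; left; apply/eqP; ring.
  have h4 : `|s| ^+ 2 * (W + g) <= `|s| * nu * ((W + g) * k * nu) + (W + g) * k * C * rho.
    have WG : 0 <= W + g := addr_ge0 W0 g0.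
    apply: le_trans (ler_wpM2r WG h1) _.
    have : C * nu * k * rho * (W + g) <= (W + g) * k * C * rho.
      have -> : C * nu * k * rho * (W + g) = ((W + g) * k * C * rho) * nu by ring.
      by rewrite ler_piMr//; exact: mulr_ge0 (mulr_ge0 A1 C0) p0.
    have -> : (`|s| * nu * (k * nu) + C * nu * k * rho) * (W + g) =
      `|s| * nu * ((W + g) * k * nu) + C * nu * k * rho * (W + g) by ring.
    lra.
  have h5 : `|s| * nu * ((W + g) * k * nu) <= `|s| * nu / 2.
    rewrite ler_wpM2l//; first by rewrite mulr_ge0// ltW.
    have := mulr_ge0 A0 (ltW nu0); nra.
  lra.
Qed.

Section SphereQuadratic.
Context {R : realType} {n : nat}.
Variables (M G : 'M[R]_n) (xb : 'cV[R]_n).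
Hypotheses (Msym : M^T = M) (MGM : M *m G *m M = M) (xb1 : enorm xb = 1).

Let u x := x - xb.
Let s x := dotv x (M *m u x).
Let r x := M *m u x - s x *: x.
Let nu x := enorm (u x).
Let rho x := enorm (r x).

Let dotvM y z : dotv (M *m y) z = dotv y (M *m z).
Proof. by rewrite dotv_mulmx Msym. Qed.

Let Mu x : M *m u x = r x + s x *: x.
Proof. by rewrite /r subrK. Qed.

Let nu_ge0 x : 0 <= nu x. Proof. exact: enorm_ge0. Qed.
Let rho_ge0 x : 0 <= rho x. Proof. exact: enorm_ge0. Qed.

Let dot_u_x x : enorm x = 1 -> dotv (u x) x = nu x ^+ 2 / 2.
Proof.
move=> x1; rewrite /nu /u sqr_enormB x1 xb1 dotvBl -sqr_enorm x1 (dotvC xb).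
by field.
Qed.

Let dot_xb_u x : enorm x = 1 -> dotv xb (u x) = - (nu x ^+ 2 / 2).
Proof.
move=> x1; rewrite /nu /u sqr_enormB x1 xb1 dotvBr -sqr_enorm xb1 (dotvC xb).
by field.
Qed.

(** The radial part of [M u] contributes to second order only, because [u] is
    almost tangent to the sphere. *)
Let quadratic_le x : enorm x = 1 ->
  `|dotv (u x) (M *m u x)| <= `|s x| * nu x ^+ 2 / 2 + nu x * rho x.
Proof.
move=> x1; rewrite Mu dotvDr dotvZr dot_u_x// addrC.
apply: le_trans (ler_normD _ _) _; apply: lerD.
  by rewrite normrM (ger0_norm (divr_ge0 (sqr_ge0 _) _))// mulrA.
exact: cauchy_schwarz.
Qed.

Let s_le C x : (forall y, enorm (M *m y) <= C * enorm y) -> enorm x = 1 ->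
  `|s x| <= C * nu x.
Proof.
by move=> hC x1; apply: le_trans (cauchy_schwarz _ _) _; rewrite x1 mul1r.
Qed.

Let Mu_le x : enorm x = 1 -> enorm (M *m u x) <= rho x + `|s x|.
Proof.
move=> x1; rewrite Mu; apply: le_trans (enorm_triangle _ _) _.
by rewrite enormZ x1 mulr1.
Qed.

Let rho_le C x : 0 <= C -> (forall y, enorm (M *m y) <= C * enorm y) -> enorm x = 1 ->
  rho x <= 2 * C * nu x.
Proof.
move=> C0 hC x1; apply: le_trans (enorm_triangleB _ _) _.
rewrite enormZ x1 mulr1; have := s_le hC x1; have := hC (u x).
by rewrite -/(nu x); lra.
Qed.

(** When [xb] is not in the range of [M], the radial part of [M u] is
    controlled by its tangential part, and the quadratic form vanishes to the
    order of a nondegenerate critical point: some [y] in the kernel of [M] is not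
    orthogonal to [xb], and pairing it with [M u] isolates [s]. *)
Let out_of_range : M *m G *m xb <> xb ->
  exists2 K, 0 < K & forall x, enorm x = 1 -> K * nu x <= 1 ->
    `|dotv (u x) (M *m u x)| ^+ 3 <= K * rho x ^+ 4.
Proof.
move=> xbG.
have [y My0 yxb] : exists2 y, M *m y = 0 & dotv y xb != 0.
  pose y := xb - M *m G *m xb; exists ((1%:M - M *m G)^T *m y).
    rewrite -{1}Msym mulmxA -trmx_mul mulmxBl mul1mx MGM subrr.
    by rewrite trmx0 mul0mx.
  rewrite dotv_mulmx trmxK mulmxBl mul1mx dotvv_eq0 subr_eq0.
  by apply/eqP => /esym.
have [C C0 hC] := mulmx_bounded M.
have [g g0 hg] := mulmx_bounded G.
set d := dotv y xb in yxb *; have d0 : 0 < `|d| by rewrite normr_gt0.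
have Y0 := enorm_ge0 y.
pose a := 2 * enorm y / `|d|; have a0 : 0 <= a by rewrite divr_ge0 ?mulr_ge0.
pose B := g ^+ 3 * (1 + a) ^+ 6 * (4 * C ^+ 2).
have B0 : 0 <= B by rewrite !mulr_ge0 ?exprn_ge0 ?addr_ge0.
exists (1 + a + B); first by lra.
move=> x x1 small; have v0 := nu_ge0 x; have p0 := rho_ge0 x.
have nu1 : nu x <= 1 by nra.
have anu : a * nu x <= 1 by nra.
have sa : `|s x| <= a * rho x.
  have e : s x * (d + dotv y (u x)) = - dotv y (r x).
    have : dotv y (M *m u x) = 0 by rewrite -dotvM My0 dot0v.
    rewrite Mu dotvDr dotvZr.
    have -> : dotv y x = d + dotv y (u x) by rewrite -dotvDr addrC subrK.
    lra.
  have h1 : `|s x| * (`|d| - enorm y * nu x) <= enorm y * rho x.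
    apply: le_trans (cauchy_schwarz _ _); rewrite -[leRHS]normrN -e normrM.
    apply: ler_wpM2l => //; rewrite lerBlDr.
    have := ler_normB (d + dotv y (u x)) (dotv y (u x)); rewrite addrK => h.
    by apply: le_trans h _; rewrite lerD2l cauchy_schwarz.
  have h2 : enorm y * nu x <= `|d| / 2.
    have -> : enorm y = a * `|d| / 2 by rewrite /a; field; rewrite gt_eqF.
    by nra.
  rewrite /a mulrAC ler_pdivlMr//; have := normr_ge0 (s x); nra.
have q1 : `|dotv (u x) (M *m u x)| <= g * (1 + a) ^+ 2 * rho x ^+ 2.
  rewrite -{1}MGM -!mulmxA -dotvM; apply: le_trans (cauchy_schwarz _ _) _.
  have := Mu_le x1; have := hg (M *m u x); have := enorm_ge0 (M *m u x).
  set Y := enorm (M *m u x); set Z := enorm (G *m _) => Yp Zg Ys.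
  have Yb : Y <= (1 + a) * rho x by lra.
  apply: (@le_trans _ _ (g * Y ^+ 2)).
    by rewrite expr2 mulrCA ler_wpM2l.
  by rewrite -mulrA -exprMn ler_wpM2l// lerXn2r// nnegrE// mulr_ge0// addr_ge0.
have rb := rho_le C0 hC x1.
have h3 := lerXn2r 3 (normr_ge0 _) (le_trans (normr_ge0 _) q1) q1.
apply: (le_trans h3).
have r2 : rho x ^+ 2 <= 4 * C ^+ 2.
  have -> : 4 * C ^+ 2 = (2 * C) ^+ 2 by ring.
  rewrite lerXn2r ?nnegrE// ?mulr_ge0//; apply: le_trans rb _.
  by rewrite ler_piMr// mulr_ge0.
apply: (@le_trans _ _ (B * rho x ^+ 4)); last first.
  by rewrite ler_wpM2r ?exprn_ge0//; lra.
have -> : (g * (1 + a) ^+ 2 * rho x ^+ 2) ^+ 3 =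
  (g ^+ 3 * (1 + a) ^+ 6) * rho x ^+ 2 * rho x ^+ 4 by ring.
by rewrite ler_wpM2r ?exprn_ge0// ler_wpM2l// !mulr_ge0 ?exprn_ge0 ?addr_ge0.
Qed.

(** When [xb] is in the range of [M], the quadratic form is [O(nu * rho)] and
    [nu^3] is [O(rho)], which gives the exponents of the statement. *)
Let in_range : M *m G *m xb = xb ->
  exists2 K, 0 < K & forall x, enorm x = 1 -> K * nu x <= 1 ->
    `|dotv (u x) (M *m u x)| ^+ 3 <= K * rho x ^+ 4.
Proof.
move=> xbG.
have [C C0 hC] := mulmx_bounded M.
have [g g0 hg] := mulmx_bounded G.
pose w := G *m xb; have Mw : M *m w = xb by rewrite mulmxA.
have [K K0 hK] := radial_estimate (dotv w xb) C0 g0 (enorm_ge0 w).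
pose B := (K + 1) ^+ 3 * K.
have B0 : 0 < B by rewrite mulr_gt0// exprn_gt0// addr_gt0.
exists (1 + K + B); first by lra.
move=> x x1 small; have v0 := nu_ge0 x; have p0 := rho_ge0 x.
have nu1 : nu x <= 1 by nra.
have Knu : K * nu x <= 1 by nra.
pose z := u x - G *m (M *m u x).
have Mz : M *m z = 0 by rewrite mulmxBr !mulmxA MGM subrr.
have xE : x = u x + xb by rewrite subrK.
have MuE : M *m u x = r x + s x *: (u x + xb) by rewrite -xE.
have GMu : G *m (M *m u x) = G *m r x + s x *: (G *m u x) + s x *: w.
  by rewrite [in LHS]MuE (mulmxDr G (r x)) -scalemxAr (mulmxDr G (u x)) scalerDr addrA.
have [snu nu3] : `|s x| * nu x <= K * rho x /\ nu x ^+ 3 <= K * rho x.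
  apply: (hK (s x) (nu x) (rho x) (dotv (G *m r x) (u x)) (dotv (G *m u x) (u x))
           (dotv w (u x)) (dotv z (r x)) (dotv w (r x))) => //.
  - exact: s_le.
  - apply: le_trans (cauchy_schwarz _ _) _; rewrite ler_wpM2r//; exact: hg.
  - apply: le_trans (cauchy_schwarz _ _) _; rewrite expr2 mulrA ler_wpM2r//; exact: hg.
  - exact: cauchy_schwarz.
  - apply: le_trans (cauchy_schwarz _ _) _; rewrite ler_wpM2r//.
    apply: le_trans (enorm_triangleB _ _) _; rewrite mulrDl mul1r lerD2l -mulrA.
    by apply: le_trans (hg _) _; rewrite ler_wpM2l.
  - exact: cauchy_schwarz.
  - have zM : dotv z (M *m u x) = 0 by rewrite -dotvM Mz dot0v.
    have zxb : dotv z xb = 0 by rewrite -Mw -dotvM Mz dot0v.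
    have zu : dotv z (u x) = nu x ^+ 2 - dotv (G *m r x) (u x)
        - s x * dotv w (u x) - s x * dotv (G *m u x) (u x).
      by rewrite dotvBl GMu (dotvDl _ (s x *: w)) (dotvDl (G *m r x)) !dotvZl -sqr_enorm; rewrite /nu; ring.
    move: zM; rewrite -zu MuE dotvDr dotvZr (dotvDr (u x)) zxb; lra.
  - have := dot_xb_u x1; rewrite -{1}Mw dotvM MuE dotvDr dotvZr (dotvDr (u x)); lra.
have q1 : `|dotv (u x) (M *m u x)| <= (K + 1) * (nu x * rho x).
  apply: le_trans (quadratic_le x1) _.
  have : `|s x| * nu x ^+ 2 / 2 <= K * (nu x * rho x) / 2.
    rewrite ler_pM2r// expr2 mulrA; have := ler_wpM2r v0 snu; lra.
  have := mulr_ge0 v0 p0; nra.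
have := lerXn2r 3 (normr_ge0 _) (le_trans (normr_ge0 _) q1) q1.
move=> /le_trans; apply.
apply: (@le_trans _ _ (B * rho x ^+ 4)); last first.
  by rewrite ler_wpM2r ?exprn_ge0//; lra.
have -> : ((K + 1) * (nu x * rho x)) ^+ 3 = (K + 1) ^+ 3 * (nu x ^+ 3 * rho x ^+ 3) by ring.
have -> : B * rho x ^+ 4 = (K + 1) ^+ 3 * (K * rho x * rho x ^+ 3) by rewrite /B; ring.
by rewrite ler_wpM2l ?exprn_ge0 ?addr_ge0 ?ler_wpM2r ?exprn_ge0// ltW.
Qed.

Lemma quadratic_lojasiewicz_ginverse :
  exists2 K, 0 < K & forall x, enorm x = 1 -> K * nu x <= 1 ->
    `|dotv (u x) (M *m u x)| ^+ 3 <= K * rho x ^+ 4.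
Proof.
have [/eqP/in_range//|/eqP/out_of_range//] := boolP (M *m G *m xb == xb).
Qed.

End SphereQuadratic.

(** The form [u^T M u / 2] is the variation on the sphere of a quadratic function
    with critical point [xb], when [M] is its Hessian minus the Lagrange
    multiplier; the vector on the right is the tangential gradient at [x]. *)
Lemma quadratic_lojasiewicz {R : realType} {n : nat} (M : 'M[R]_n) (xb : 'cV[R]_n) :
  M^T = M -> enorm xb = 1 ->
  exists2 K, 0 < K & forall x, enorm x = 1 -> K * enorm (x - xb) <= 1 ->
    `|dotv (x - xb) (M *m (x - xb))| ^+ 3 <=
    K * enorm (M *m (x - xb) - dotv x (M *m (x - xb)) *: x) ^+ 4.
Proof.
by move=> Ms; apply: (quadratic_lojasiewicz_ginverse Ms (G := pinvmx M)); rewrite mulmxKpV.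
Qed.

(** * Tangential gradients *)

(** Orthogonal projection onto the tangent space of the unit sphere at [x], for
    [x] a unit vector. *)
Definition tangent {R : realType} {n : nat} (x g : 'cV[R]_n) : 'cV[R]_n :=
  g - dotv x g *: x.

Section Tangent.
Context {R : realType} {n : nat}.
Implicit Types (x y g : 'cV[R]_n).

Lemma tangentB x g h : tangent x (g - h) = tangent x g - tangent x h.
Proof. by rewrite /tangent dotvBr; apply/colP => i; rewrite !mxE; ring. Qed.

Lemma tangentD x g h : tangent x (g + h) = tangent x g + tangent x h.
Proof. by rewrite /tangent dotvDr; apply/colP => i; rewrite !mxE; ring. Qed.

Lemma tangent_self x a : enorm x = 1 -> tangent x (a *: x) = 0.
Proof.
by move=> x1; rewrite /tangent dotvZr -sqr_enorm x1 expr1n mulr1 subrr.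
Qed.

Lemma tangent_le x g : enorm x = 1 -> enorm (tangent x g) <= enorm g.
Proof.
move=> x1; rewrite -(@ler_pXn2r _ 2) ?nnegrE ?enorm_ge0// sqr_enormB enormZ x1.
rewrite dotvZr (dotvC g) mulr1 -[`|_| ^+ 2]normrX ger0_norm ?sqr_ge0//.
by have := sqr_ge0 (dotv x g); lra.
Qed.

Lemma tangent_lip x y g h : enorm x = 1 -> enorm y = 1 ->
  enorm (tangent x g - tangent y h) <= enorm (g - h) + 2 * enorm g * enorm (x - y).
Proof.
move=> x1 y1.
have -> : tangent x g - tangent y h =
    tangent y (g - h) - (dotv (x - y) g *: x + dotv y g *: (x - y)).
  rewrite tangentB /tangent dotvBl scalerBl scalerBr.
  by apply/colP => i; rewrite !mxE; ring.
apply: le_trans (enorm_triangleB _ _) _; apply: lerD; first exact: tangent_le.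
apply: le_trans (enorm_triangle _ _) _; rewrite !enormZ x1.
have := cauchy_schwarz (x - y) g; have := cauchy_schwarz y g.
have := enorm_ge0 (x - y); rewrite y1; nra.
Qed.

End Tangent.

(** * Combinations of squared hinges *)

Definition pospart {R : realType} (t : R) : R := Num.max 0 t.

Section Pospart.
Context {R : realType}.
Implicit Types (t d : R).

Lemma pospart_pos t : 0 <= t -> pospart t = t.
Proof. by move=> h; rewrite /pospart; apply/max_idPr. Qed.

Lemma pospart_neg t : t <= 0 -> pospart t = 0.
Proof. by move=> h; rewrite /pospart; apply/max_idPl. Qed.

Lemma pospart_lip t d : `|pospart t - pospart d| <= `|t - d|.
Proof.
rewrite ler_norml; have [t0|/ltW t0] := leP 0 t; have [d0|/ltW d0] := leP 0 d;
  rewrite ?(pospart_pos t0) ?(pospart_pos d0) ?(pospart_neg t0) ?(pospart_neg d0);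
  have := ler_norm (t - d); have := ler_norm (- (t - d)); rewrite normrN;
  move=> *; apply/andP; split; lra.
Qed.

Lemma sqr_pospart_taylor t d :
  `|pospart (t + d) ^+ 2 - pospart t ^+ 2 - 2 * pospart t * d| <= d ^+ 2.
Proof.
rewrite ler_norml; have [t0|/ltW t0] := leP 0 t; have [d0|/ltW d0] := leP 0 (t + d);
  rewrite ?(pospart_pos t0) ?(pospart_pos d0) ?(pospart_neg t0) ?(pospart_neg d0);
  apply/andP; split; nra.
Qed.

End Pospart.

(** In this form of a [C^1] piecewise quadratic function the quadratic pieces are
    indexed by the sets of active hinges, so that finitely many boolean patterns
    describe all of them without any polyhedral geometry. *)
Section Hinge.
Context {R : realType} {n : nat} {J : finType}.
Variables (c e : J -> R) (a : J -> 'cV[R]_n).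
Implicit Types (x y u v : 'cV[R]_n).

Let h j x := dotv (a j) x + e j.

Definition hinge x : R := \sum_j c j * pospart (h j x) ^+ 2.

Definition hinge_grad x : 'cV[R]_n := \sum_j (2 * c j * pospart (h j x)) *: a j.

Let hD j x v : h j (x + v) = h j x + dotv (a j) v.
Proof. by rewrite /h dotvDr addrAC. Qed.

Lemma hinge_taylor : exists2 C, 0 <= C &
  forall x v, `|hinge (x + v) - hinge x - dotv (hinge_grad x) v| <= C * enorm v ^+ 2.
Proof.
exists (\sum_j `|c j| * enorm (a j) ^+ 2).
  by apply: sumr_ge0 => j _; rewrite mulr_ge0// sqr_ge0.
move=> x v; rewrite /hinge /hinge_grad dotv_suml -!sumrB mulr_suml.
apply: le_trans (ler_norm_sum _ _ _) _; apply: ler_sum => j _.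
rewrite hD dotvZl.
have -> : c j * pospart (h j x + dotv (a j) v) ^+ 2 - c j * pospart (h j x) ^+ 2 -
     2 * c j * pospart (h j x) * dotv (a j) v =
  c j * (pospart (h j x + dotv (a j) v) ^+ 2 - pospart (h j x) ^+ 2
     - 2 * pospart (h j x) * dotv (a j) v) by ring.
rewrite normrM -[leRHS]mulrA ler_wpM2l//; apply: le_trans (sqr_pospart_taylor _ _) _.
rewrite -exprMn -[leLHS]ger0_norm ?sqr_ge0// normrX.
by rewrite lerXn2r ?nnegrE ?mulr_ge0 ?enorm_ge0// cauchy_schwarz.
Qed.

Lemma hinge_grad_lip : exists2 L, 0 <= L &
  forall x y, enorm (hinge_grad x - hinge_grad y) <= L * enorm (x - y).
Proof.
exists (\sum_j `|2 * c j| * enorm (a j) ^+ 2).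
  by apply: sumr_ge0 => j _; rewrite mulr_ge0// sqr_ge0.
move=> x y; rewrite /hinge_grad -sumrB mulr_suml.
apply: le_trans (enorm_sum _) _; apply: ler_sum => j _.
rewrite -scalerBl -mulrBr enormZ (normrM (2 * c j)).
have -> : `|2 * c j| * enorm (a j) ^+ 2 * enorm (x - y) =
  `|2 * c j| * (enorm (a j) * enorm (x - y)) * enorm (a j) by ring.
rewrite ler_wpM2r ?enorm_ge0// ler_wpM2l//; apply: le_trans (pospart_lip _ _) _.
have -> : h j x - h j y = dotv (a j) (x - y) by rewrite /h dotvBr; ring.
exact: cauchy_schwarz.
Qed.

Section Critical.
Variables (P : 'M[R]_n) (xb : 'cV[R]_n).
Hypotheses (Psym : P^T = P) (Pxb : P *m xb = xb) (xb1 : enorm xb = 1).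
Hypothesis crit : tangent xb (P *m hinge_grad xb) = 0.

Let mu := dotv xb (P *m hinge_grad xb).

Let PGxb : P *m hinge_grad xb = mu *: xb.
Proof. by apply/eqP; rewrite -subr_eq0 -/(tangent _ _) crit. Qed.

Let Q (b : {ffun J -> bool}) : 'M[R]_n :=
  \sum_j (2 * c j * (b j)%:R) *: (a j *m (a j)^T).

Let Qmul b u : Q b *m u = \sum_j (2 * c j * (b j)%:R * dotv (a j) u) *: a j.
Proof.
rewrite /Q mulmx_suml; apply: eq_bigr => j _.
by rewrite -scalemxAl -mulmxA [_ *m u]mx11_scalar -dotvE mul_mx_scalar !scalerA.
Qed.

Let Qsym b : (Q b)^T = Q b.
Proof.
rewrite /Q raddf_sum; apply: eq_bigr => j _ /=.
by rewrite linearZ /= trmx_mul trmxK.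
Qed.

(** [x] and [xb] lie in the closure of the same quadratic piece. *)
Let compatible (b : {ffun J -> bool}) x := forall j,
  pospart (h j x) = (b j)%:R * h j x /\ pospart (h j xb) = (b j)%:R * h j xb.

(** The Hessian of the piece [b] on the range of [P], minus the Lagrange
    multiplier [mu] of the sphere constraint. *)
Let M b := P *m (Q b - mu%:M) *m P.

Let Msym b : (M b)^T = M b.
Proof.
by rewrite /M !trmx_mul Psym linearB /= Qsym tr_scalar_mx mulmxA.
Qed.

Let Mu b x : P *m x = x -> M b *m (x - xb) = P *m (Q b *m (x - xb)) - mu *: (x - xb).
Proof.
move=> Px; have Pu : P *m (x - xb) = x - xb by rewrite mulmxBr Px Pxb.
by rewrite /M -2!mulmxA Pu mulmxBl mulmxBr mul_scalar_mx -scalemxAr Pu.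
Qed.

Let grad_diff b x : compatible b x ->
  hinge_grad x = hinge_grad xb + Q b *m (x - xb).
Proof.
move=> cb; rewrite Qmul /hinge_grad -big_split /=; apply: eq_bigr => j _.
have [-> ->] := cb j; rewrite -scalerDl; congr (_ *: _).
by rewrite /h dotvBr; ring.
Qed.

Let value_diff b x : compatible b x ->
  hinge x - hinge xb =
  dotv (hinge_grad xb) (x - xb) + dotv (x - xb) (Q b *m (x - xb)) / 2.
Proof.
move=> cb; rewrite (dotvC _ (Q b *m _)) Qmul /hinge /hinge_grad !dotv_suml -sumrB.
rewrite mulr_suml -big_split /=; apply: eq_bigr => j _.
have [-> ->] := cb j; rewrite !dotvZl /h dotvBr.
by case: (b j) => /=; field.
Qed.

Let reduction b x : P *m x = x -> enorm x = 1 -> compatible b x ->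
  hinge x - hinge xb = dotv (x - xb) (M b *m (x - xb)) / 2 /\
  tangent x (P *m hinge_grad x) = tangent x (M b *m (x - xb)).
Proof.
move=> Px x1 cb.
have Pu : P *m (x - xb) = x - xb by rewrite mulmxBr Px Pxb.
split.
- have gu : dotv (hinge_grad xb) (x - xb) = mu * dotv xb (x - xb).
    by rewrite -{1}Pu -{1}Psym -dotv_mulmx PGxb dotvZl.
  have qu : dotv (x - xb) (P *m (Q b *m (x - xb))) = dotv (x - xb) (Q b *m (x - xb)).
    by rewrite -{1}Psym -dotv_mulmx Pu.
  have nu : dotv xb (x - xb) = - (dotv (x - xb) (x - xb) / 2).
    have := sqr_enorm x; have := sqr_enorm xb; rewrite x1 xb1 !dotv_lin (dotvC x xb); lra.
  rewrite (value_diff cb) (Mu b Px) (dotvBr (P *m _)) dotvZr qu gu nu; lra.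
- rewrite (grad_diff cb) mulmxDr PGxb (Mu b Px).
  move: (P *m (Q b *m (x - xb))) => v.
  have -> : mu *: xb + v = v - mu *: (x - xb) + mu *: x.
    by apply/colP => i; rewrite !mxE; ring.
  by rewrite tangentD tangent_self// addr0.
Qed.

(** Each point near [xb] shares a quadratic piece with [xb], and there both the
    variation of the function and its tangential gradient are those of the form
    [M b]. *)
Lemma hinge_lojasiewicz_critical : exists2 K, 0 < K &
  forall x, enorm x = 1 -> P *m x = x -> K * enorm (x - xb) <= 1 ->
    `|hinge x - hinge xb| ^+ 3 <= K * enorm (tangent x (P *m hinge_grad x)) ^+ 4.
Proof.
have /choice[K hK] : forall b, exists K, 0 < K /\
    forall x, enorm x = 1 -> K * enorm (x - xb) <= 1 ->
    `|dotv (x - xb) (M b *m (x - xb))| ^+ 3 <= K * enorm (tangent x (M b *m (x - xb))) ^+ 4.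
  by move=> b; have [K K0 hK] := quadratic_lojasiewicz (Msym b) xb1; exists K.
(* at distance less than [1 / k j] the hinge [j] has the same sign as at [xb]; if
   it vanishes at [xb], both of its pieces are valid there and [k j = 0] rightly
   imposes nothing *)
pose k j := (enorm (a j) + 1) / `|h j xb|.
have k0 j : 0 <= k j by rewrite divr_ge0// addr_ge0// enorm_ge0.
have SK b : 0 <= K b <= \sum_b K b.
  have [Kb _] := hK b; rewrite ltW//= (bigD1 b)//= lerDl sumr_ge0// => b' _.
  by have [/ltW] := hK b'.
have Sk j : k j <= \sum_j k j.
  by rewrite (bigD1 j)//= lerDl sumr_ge0.
have SK0 : 0 <= \sum_b K b by apply: sumr_ge0 => b _; have /andP[] := SK b.
have Sk0 : 0 <= \sum_j k j by apply: sumr_ge0.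
exists (1 + \sum_b K b + \sum_j k j); first by lra.
move=> x x1 Px small; have v0 := enorm_ge0 (x - xb).
pose b : {ffun J -> bool} := [ffun j => 0 < h j x].
have cb : compatible b x.
  move=> j; rewrite ffunE; split.
    have [p|p] := ltP 0 (h j x); first by rewrite mul1r pospart_pos// ltW.
    by rewrite mul0r pospart_neg.
  have [z|z] := eqVneq (h j xb) 0; first by rewrite z mulr0 pospart_neg.
  have hx : h j x = h j xb + dotv (a j) (x - xb) by rewrite -hD addrC subrK.
  have : `|dotv (a j) (x - xb)| < `|h j xb|.
    have z0 : 0 < `|h j xb| by rewrite normr_gt0.
    apply: le_lt_trans (cauchy_schwarz _ _) _.
    have [->|v1] := eqVneq (enorm (x - xb)) 0; first by rewrite mulr0.
    apply: (@lt_le_trans _ _ ((enorm (a j) + 1) * enorm (x - xb))).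
      by rewrite ltr_pM2r ?ltrDl// lt_def v1.
    have -> : enorm (a j) + 1 = k j * `|h j xb| by rewrite divfK// gt_eqF.
    rewrite mulrAC ler_piMl//; apply: le_trans small; rewrite ler_wpM2r//.
    by have := Sk j; lra.
  rewrite ltr_norml => /andP[l1 l2].
  have [p|p] := ltP 0 (h j xb).
    rewrite pospart_pos ?ltW// hx; move: l1 l2; rewrite (gtr0_norm p) => l1 l2.
    by rewrite (_ : 0 < _) ?mul1r//; lra.
  rewrite pospart_neg// hx; move: l1 l2; rewrite (ler0_norm p) => l1 l2.
  by rewrite (_ : 0 < _ = false) ?mul0r//; apply/negbTE; rewrite -leNgt; lra.
have [-> ->] := reduction Px x1 cb.
have [Kb0 /(_ _ x1) hb] := hK b; have /andP[_ Kb] := SK b.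
rewrite normrM exprMn; apply: (@le_trans _ _ (`|dotv (x - xb) (M b *m (x - xb))| ^+ 3)).
  by rewrite ler_piMr ?exprn_ge0// exprn_ile1// ger0_norm// invf_le1// ler1n.
apply: le_trans (hb _) _.
  by apply: le_trans small; rewrite ler_wpM2r//; lra.
by rewrite ler_wpM2r ?exprn_ge0 ?enorm_ge0//; lra.
Qed.

End Critical.

End Hinge.

(** If [nu] is a distance to a point where a quantity has norm [d > 0], and [L] a
    Lipschitz constant of that quantity, then it is not of size [1 / K] within
    distance [1 / K]. *)
Lemma separation {R : realType} (d L : R) : 0 < d -> 0 <= L ->
  exists2 K, 0 < K & forall nu p, 0 <= nu -> K * nu <= 1 -> K * p <= 1 ->
    (nu <= 1 -> d <= p + L * nu) -> False.
Proof.
move=> d0 L0; have q0 : 0 <= (1 + L) / d by rewrite divr_ge0 ?ltW//; lra.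
exists (1 + 2 * ((1 + L) / d)); first by lra.
move=> nu p v0 kv kp; have v1 : nu <= 1 by nra.
move=> /(_ v1); apply/negP; rewrite -ltNge.
set K := 1 + _ in kv kp.
have Kd : 1 + L < K * d.
  rewrite /K mulrDl mul1r -mulrA divfK ?gt_eqF//; lra.
rewrite -(ltr_pM2l (_ : 0 < K)); last by rewrite /K; lra.
apply: le_lt_trans Kd.
by have := ler_wpM2l L0 kv; lra.
Qed.

Section HingeUniform.
Context {R : realType} {n : nat} {J : finType}.
Variables (c e : J -> R) (a : J -> 'cV[R]_n) (P : 'M[R]_n) (fs : R).
Hypothesis Psym : P^T = P.

Let f := hinge c e a.
Let g x := P *m hinge_grad c e a x.

(** Only critical points of value [fs] in the range of [P] matter: near any other
    point of the sphere one of the hypotheses fails. *)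
Lemma hinge_lojasiewicz : exists2 K, 0 < K &
  forall x, enorm x = 1 -> P *m x = x -> K * `|f x - fs| <= 1 ->
    K * enorm (tangent x (g x)) <= 1 ->
    `|f x - fs| ^+ 3 <= K * enorm (tangent x (g x)) ^+ 4.
Proof.
apply: (unit_sphere_uniform (P := fun K x => P *m x = x -> K * `|f x - fs| <= 1 ->
    K * enorm (tangent x (g x)) <= 1 ->
    `|f x - fs| ^+ 3 <= K * enorm (tangent x (g x)) ^+ 4)).
  move=> K K' x KK' h Px h1 h2.
  have w (z : R) : 0 <= z -> K' * z <= 1 -> K * z <= 1.
    by move=> z0; apply: le_trans; rewrite ler_wpM2r.
  apply: le_trans (h Px (w _ _ h1) (w _ _ h2)) _; rewrite ?enorm_ge0//.
  by rewrite ler_wpM2r// exprn_ge0// enorm_ge0.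
have [B B0 hB] := mulmx_bounded P.
have [C C0 hC] := hinge_taylor c e a.
have [L L0 hL] := hinge_grad_lip c e a.
move=> xb xb1.
have [Pxb|Pxb] := eqVneq (P *m xb) xb; last first.
  have d0 : 0 < enorm (P *m xb - xb) by rewrite enorm_gt0 subr_eq0.
  have [K K0 hK] := separation d0 (addr_ge0 B0 ler01).
  exists K => // x x1 small Px; exfalso.
  apply: (hK _ 0 (enorm_ge0 _) small); first by rewrite mulr0.
  move=> _; rewrite add0r.
  have -> : P *m xb - xb = (x - xb) - P *m (x - xb).
    by rewrite mulmxBr Px; apply/colP => i; rewrite !mxE; ring.
  by apply: le_trans (enorm_triangleB _ _) _; have := hB (x - xb); lra.
have [fxb|fxb] := eqVneq (f xb) fs; last first.
  have d0 : 0 < `|f xb - fs| by rewrite normr_gt0 subr_eq0.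
  have gb0 := enorm_ge0 (hinge_grad c e a xb).
  have [K K0 hK] := separation d0 (addr_ge0 gb0 C0).
  exists K => // x x1 small Px h _; exfalso.
  apply: (hK _ _ (enorm_ge0 _) small h) => v1.
  have v0 := enorm_ge0 (x - xb).
  have -> : f xb - fs = (f x - fs) - (f x - f xb) by ring.
  apply: le_trans (ler_normB _ _) _; rewrite lerD2l.
  have -> : f x - f xb = (f (xb + (x - xb)) - f xb - dotv (hinge_grad c e a xb) (x - xb))
     + dotv (hinge_grad c e a xb) (x - xb) by rewrite [xb + _]addrC !subrK; ring.
  apply: le_trans (ler_normD _ _) _.
  have h1 := hC xb (x - xb); have h2 := cauchy_schwarz (hinge_grad c e a xb) (x - xb).
  rewrite mulrDl addrC; apply: lerD => //; apply: le_trans h1 _.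
  by rewrite ler_wpM2l// expr2 ler_piMr.
have gL x : enorm (g x - g xb) <= B * L * enorm (x - xb).
  by rewrite -mulmxBr; apply: le_trans (hB _) _; rewrite -mulrA ler_wpM2l.
have [t0|t0] := eqVneq (tangent xb (g xb)) 0; last first.
  have d0 : 0 < enorm (tangent xb (g xb)) by rewrite enorm_gt0.
  have gb0 := enorm_ge0 (g xb).
  have [|K K0 hK] := separation (L := B * L + 2 * enorm (g xb)) d0.
    by rewrite addr_ge0 ?mulr_ge0.
  exists K => // x x1 small Px _ h; exfalso.
  apply: (hK _ _ (enorm_ge0 _) small h) => v1.
  have -> : tangent xb (g xb) = tangent x (g x) - (tangent x (g x) - tangent xb (g xb)).
    by rewrite opprB addrC subrK.
  apply: le_trans (enorm_triangleB _ _) _; rewrite lerD2l enormB.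
  apply: le_trans (tangent_lip _ _ _ _) _ => //.
  by rewrite (enormB xb x) (enormB (g xb)) [leRHS]mulrDl lerD2r.
have [K K0 hK] := hinge_lojasiewicz_critical Psym Pxb xb1 t0.
by exists K => // x x1 small Px _ _; rewrite -fxb; exact: hK.
Qed.

End HingeUniform.

(** * Gradients and descent from Taylor estimates *)

Section TaylorGradient.
Context {R : realType} {n : nat}.
Variables (f : 'cV[R]_n -> R) (G : 'cV[R]_n -> 'cV[R]_n) (C : R).
Hypothesis taylor : forall x v, `|f (x + v) - f x - dotv (G x) v| <= C * enorm v ^+ 2.

Lemma taylor_cvg x v :
  (fun h : R => h^-1 *: (f (h *: v + x) - f x)) @ 0^' --> dotv (G x) v.
Proof.
apply/cvgrPdist_le => eps eps0.
pose D := C * enorm v ^+ 2.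
have D0 : 0 <= D by apply: le_trans _ (taylor x v).
near=> h.
have h0 : h != 0 by near: h; exact: nbhs_dnbhs_neq.
have hh : 0 < `|h| by rewrite normr_gt0.
have -> : dotv (G x) v - h^-1 *: (f (h *: v + x) - f x) =
    - (h^-1 * (f (x + h *: v) - f x - dotv (G x) (h *: v))).
  rewrite dotvZr [h *: v + x]addrC mulrBr mulrA mulVf// mul1r opprB.
  by congr (_ - _); rewrite mulrBr.
rewrite normrN normrM normfV ler_pdivrMl//; apply: le_trans (taylor _ _) _.
rewrite enormZ exprMn mulrCA -/D expr2 -mulrA ler_wpM2l//.
have hD : `|h| <= eps / (D + 1).
  near: h; apply: dnbhs0_le; rewrite divr_gt0//; lra.
apply: (@le_trans _ _ (eps / (D + 1) * D)); first by rewrite ler_wpM2r.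
by rewrite mulrAC ler_pdivrMr ?ler_wpM2l ?ltW//; lra.
Unshelve. all: by end_near. Qed.

Lemma taylor_grad : grad f = G.
Proof.
apply/funext => x; apply/colP => i; rewrite mxE -dotv_delta.
by apply: cvg_lim => //; exact: taylor_cvg.
Qed.

Lemma taylor_is_derive x v (t : R) :
  is_derive t (1 : R) (fun s => f (x + s *: v)) (dotv (G (x + t *: v)) v).
Proof.
have : (fun h : R => h^-1 *: (((fun s => f (x + s *: v)) \o shift t) (h *: (1 : R)) -
   f (x + t *: v))) @ 0^' --> dotv (G (x + t *: v)) v.
  rewrite (_ : (fun h => _) = (fun h : R => h^-1 *: (f (h *: v + (x + t *: v)) - f (x + t *: v)))).
    exact: taylor_cvg.
  apply/funext => h /=; congr (_ *: (f _ - _)).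
  by rewrite scalerDl [h *: 1]mulr1 addrCA.
move=> cv; apply: DeriveDef; first by apply/cvg_ex; exists (dotv (G (x + t *: v)) v).
exact: cvg_lim.
Qed.

(** The mean value theorem on the segment improves the constant [C] of the given
    Taylor estimate to half of any Lipschitz modulus of the gradient. *)
Lemma descent_lemma L : (forall x y, enorm (G x - G y) <= L * enorm (x - y)) ->
  forall x v, `|f (x + v) - f x - dotv (G x) v| <= L / 2 * enorm v ^+ 2.
Proof.
move=> GL x v.
(* the sign [s] treats the upper and the lower bound at once: for both of them
   [phi] is nonincreasing *)
have key (s : R) : s ^+ 2 = 1 ->
    s * (f (x + v) - f x - dotv (G x) v) <= L / 2 * enorm v ^+ 2.
  move=> s1.
  pose phi t := s * f (x + t *: v) - t * (s * dotv (G x) v) - t ^+ 2 * (L / 2 * enorm v ^+ 2).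
  pose dphi t := s * dotv (G (x + t *: v) - G x) v - t * (L * enorm v ^+ 2).
  have phiD (t : R) : is_derive t (1 : R) phi (dphi t).
    have D := taylor_is_derive x v t.
    rewrite /phi; apply: is_derive_eq.
    by rewrite /dphi dotvBl /GRing.scale /=; field.
  have phi_cont : {within `[0, 1], continuous phi}.
    apply: derivable_within_continuous => t _; exact: ex_derive.
  have [t /itvP t01] := MVT (@ltr01 R) (fun t _ => phiD t) phi_cont.
  rewrite subr0 mulr1 => e.
  have : dphi t <= 0.
    rewrite /dphi subr_le0; have t0 : 0 <= t by rewrite t01.
    apply: (@le_trans _ _ (`|s * dotv (G (x + t *: v) - G x) v|)); first exact: ler_norm.
    rewrite normrM (_ : `|s| = 1); last first.
      by apply/eqP; rewrite -(@eqrXn2 _ 2)// -normrX s1 normr1 expr1n.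
    rewrite mul1r; apply: le_trans (cauchy_schwarz _ _) _.
    apply: le_trans (ler_wpM2r (enorm_ge0 _) (GL _ _)) _.
    by rewrite addrC addKr enormZ ger0_norm// le_eqVlt; apply/orP; left; apply/eqP; ring.
  rewrite -e /phi scale1r scale0r addr0; lra.
have := key 1 (expr1n _ _); have := key (-1) (etrans (sqrrN 1) (expr1n _ _)).
rewrite ler_norml => *; apply/andP; split; lra.
Qed.

End TaylorGradient.

(** The infimum is attained, because each pair of points bounds the admissible
    moduli from below by a difference quotient. *)
Lemma lipschitz_constP {R : realType} {n p : nat} (G : 'cV[R]_n -> 'cV[R]_p) (L : R) :
  0 <= L -> (forall x y, enorm (G x - G y) <= L * enorm (x - y)) ->
  0 <= lipschitz_const G /\
  forall x y, enorm (G x - G y) <= lipschitz_const G * enorm (x - y).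
Proof.
move=> L0 hL; rewrite /lipschitz_const; set S := (X in inf X).
have S0 : S !=set0 by exists L.
split; first by apply: lb_le_inf => // z [].
move=> x y; have [->|xy] := eqVneq x y.
  by rewrite !subrr !enorm0 mulr0.
have d0 : 0 < enorm (x - y) by rewrite enorm_gt0 subr_eq0.
rewrite -ler_pdivrMr//; apply: lb_le_inf => // z [z0 hz].
by rewrite ler_pdivrMr.
Qed.

(** * The smoothed ramp loss *)

Section Loss.
Context {R : realType} {m n : nat}.
Variables (A : 'M[R]_(m, n)) (sigma gamma : R).
Hypotheses (gamma_gt0 : 0 < gamma) (gamma_lt : gamma < sigma / 2).

(** The derivative of [vartheta] is piecewise linear and continuous, with slope
    jumps at [0], [- gamma], [gamma - sigma] and [- (sigma + gamma)]; each jump,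
    counted as [t] decreases, contributes half its size times a squared hinge. *)
Lemma vartheta_pospart (t : R) : vartheta sigma gamma t =
  (2 * gamma)^-1 * (pospart (- t) ^+ 2 - pospart (- t - gamma) ^+ 2)
  - (4 * gamma)^-1 * (pospart (- t - (sigma - gamma)) ^+ 2
                      - pospart (- t - (sigma + gamma)) ^+ 2).
Proof.
have g0 : gamma != 0 by rewrite gt_eqF.
have [gp gl] := (gamma_gt0, gamma_lt); rewrite /vartheta.
have [h1|h1] := ltP 0 t.
  by rewrite !pospart_neg; try lra; field.
rewrite [pospart (- t)]pospart_pos; last by lra.
have [h2|h2] := ltP (- gamma) t.
  by rewrite !pospart_neg; try lra; field.
rewrite [pospart (- t - gamma)]pospart_pos; last by lra.
have [h3|h3] := ltP (- sigma + gamma) t.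
  by rewrite !pospart_neg; try lra; field.
rewrite [pospart (- t - (sigma - gamma))]pospart_pos; last by lra.
have [h4|h4] := leP (- (sigma + gamma)) t.
  by rewrite !pospart_neg; try lra; field.
by rewrite pospart_pos; try lra; field.
Qed.

Let J : finType := ('I_m * (bool * bool))%type.
Let c (j : J) : R := match j.2 with
  | (false, false) => (2 * gamma)^-1
  | (false, true) => - (2 * gamma)^-1
  | (true, false) => - (4 * gamma)^-1
  | (true, true) => (4 * gamma)^-1 end.
Let e (j : J) : R := match j.2 with
  | (false, false) => 0
  | (false, true) => - gamma
  | (true, false) => - (sigma - gamma)
  | (true, true) => - (sigma + gamma) end.
Let a (j : J) : 'cV[R]_n := - (row j.1 A)^T.

Let loss_hinge : loss A sigma gamma = hinge c e a.
Proof.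
apply/funext => x; rewrite /loss /hinge.
transitivity (\sum_(i < m) \sum_(pq : bool * bool)
    c (i, pq) * pospart (dotv (a (i, pq)) x + e (i, pq)) ^+ 2); last first.
  by rewrite pair_bigA; apply: eq_bigr => -[].
apply: eq_bigr => i _; rewrite vartheta_pospart.
transitivity (\sum_(p : bool) \sum_(q : bool)
    c (i, (p, q)) * pospart (dotv (a (i, (p, q))) x + e (i, (p, q))) ^+ 2); last first.
  by rewrite pair_bigA; apply: eq_bigr => -[].
rewrite !big_bool /c /e /a /=.
have -> : dotv (- (row i A)^T) x = - (A *m x) i 0.
  by rewrite dotvNl dotvE trmxK -row_mul mxE.
by rewrite addr0; ring.
Qed.

Let grad_loss : grad (loss A sigma gamma) = hinge_grad c e a.
Proof.
rewrite loss_hinge; have [C _ hC] := hinge_taylor c e a; exact: taylor_grad hC.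
Qed.

Lemma loss_lipschitz : 0 <= lipschitz_const (grad (loss A sigma gamma)) /\
  forall x y, enorm (grad (loss A sigma gamma) x - grad (loss A sigma gamma) y) <=
    lipschitz_const (grad (loss A sigma gamma)) * enorm (x - y).
Proof.
rewrite grad_loss; have [L L0 hL] := hinge_grad_lip c e a.
exact: lipschitz_constP L0 hL.
Qed.

Lemma loss_descent x v :
  `|loss A sigma gamma (x + v) - loss A sigma gamma x
    - dotv (grad (loss A sigma gamma) x) v| <=
  lipschitz_const (grad (loss A sigma gamma)) / 2 * enorm v ^+ 2.
Proof.
have [_] := loss_lipschitz; move: x v.
rewrite grad_loss loss_hinge => x v h.
have [C _ hC] := hinge_taylor c e a; exact: descent_lemma hC _ h _ _.
Qed.

Lemma loss_lojasiewicz (P : 'M[R]_n) (fs : R) : P^T = P ->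
  exists2 K, 0 < K & forall x, enorm x = 1 -> P *m x = x ->
    K * `|loss A sigma gamma x - fs| <= 1 ->
    K * enorm (tangent x (P *m grad (loss A sigma gamma) x)) <= 1 ->
    `|loss A sigma gamma x - fs| ^+ 3 <=
    K * enorm (tangent x (P *m grad (loss A sigma gamma) x)) ^+ 4.
Proof. by rewrite grad_loss loss_hinge; exact: hinge_lojasiewicz. Qed.

End Loss.

(** * Real sequences with sufficient decrease *)

Section Sequences.
Context {R : realType}.
Variables (d h : nat -> R) (delta : R).
Hypotheses (d_ge0 : forall k, 0 <= d k) (h_ge0 : forall k, 0 <= h k).
Hypotheses (delta_gt0 : 0 < delta).
Hypothesis decrease : forall k, h k.+1 + delta * (d k.+1 ^+ 2 + d k ^+ 2) <= h k.

Let step k : delta * d k.+1 ^+ 2 <= h k - h k.+1.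
Proof.
have := decrease k; have := mulr_ge0 (ltW delta_gt0) (sqr_ge0 (d k)); lra.
Qed.

Lemma telescoping_bound (T : nat -> R) (N : nat) :
  (forall k, 0 <= T k) -> (forall k, (N <= k)%N -> d k.+1 / 2 <= T k - T k.+1) ->
  exists B, forall M, \sum_(0 <= k < M) d k <= B.
Proof.
move=> T0 hT; exists (\sum_(0 <= k < N.+1) d k + 2 * T N) => M.
have mono : \sum_(0 <= k < M) d k <= \sum_(0 <= k < N.+1 + M) d k.
  rewrite addnC [leRHS](big_cat_nat (n := M))//= ?leq_addr// lerDl.
  by apply: sumr_ge0.
apply: le_trans mono _; rewrite (big_cat_nat (n := N.+1))//= ?leq_addr//.
rewrite lerD2l -{1}[N.+1]add0n big_addn addKn.
suff : \sum_(0 <= i < M) d (i + N.+1)%N <= 2 * (T N - T (M + N)%N).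
  by move=> /le_trans; apply; have := T0 (M + N)%N; lra.
elim: M => [|M IH]; first by rewrite big_nil add0n subrr mulr0.
rewrite big_nat_recr//= addSn addnS.
by have := hT (M + N)%N (leq_addl _ _); lra.
Qed.

(** The Lojasiewicz argument for exponent 3/4.  With [q] the fourth root of
    [h], concavity of the fourth root turns the quadratic decrease of [h] into
    [d k.+2 ^+ 2 <= c * (d k.+1 + d k) * (q k.+1 - q k.+2)], and the right-hand
    side is a product of a sum of gaps and a telescoping term. *)
Lemma finite_length (E : R) (N : nat) : 0 <= E ->
  (forall k, (N <= k)%N -> h k.+1 ^+ 3 <= E * (d k.+1 + d k) ^+ 4) ->
  exists B, forall M, \sum_(0 <= k < M) d k <= B.
Proof.
move=> E0 loj.
pose q k := Num.sqrt (Num.sqrt (h k)).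
have q0 k : 0 <= q k by exact: sqrtr_ge0.
have q4 k : q k ^+ 4 = h k.
  by rewrite -[4%N]/(2 * 2)%N exprM !sqr_sqrtr ?sqrtr_ge0.
have hdec k : h k.+1 <= h k.
  by have := step k; have := mulr_ge0 (ltW delta_gt0) (sqr_ge0 (d k.+1)); lra.
have qdec k : q k.+1 <= q k by rewrite /q ler_sqrt ?sqrtr_ge0// ler_sqrt.
have q3 k : (N <= k)%N -> q k.+1 ^+ 3 <= (1 + E) * (d k.+1 + d k).
  move=> Nk; have D0 : 0 <= d k.+1 + d k by rewrite addr_ge0.
  have E1 : 0 <= 1 + E by lra.
  rewrite -(@ler_pXn2r _ 4) ?nnegrE ?exprn_ge0 ?mulr_ge0//.
  rewrite -exprM mulnC exprM q4; apply: le_trans (loj _ Nk) _.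
  rewrite exprMn ler_wpM2r ?exprn_ge0//.
  apply: (@le_trans _ _ (1 + E)); first by lra.
  by rewrite -[leLHS]expr1 ler_weXn2l//; lra.
pose c := 4 * (1 + E) / delta.
have c0 : 0 <= c by rewrite divr_ge0 ?ltW//; lra.
have main k : (N <= k)%N ->
    d k.+2 <= (d k.+1 + d k) / 4 + c * (q k.+1 - q k.+2).
  move=> Nk; have D0 : 0 <= d k.+1 + d k by rewrite addr_ge0.
  have qq : 0 <= q k.+1 - q k.+2 by rewrite subr_ge0.
  have Y0 : 0 <= c * (q k.+1 - q k.+2) by rewrite mulr_ge0.
  suff sq : d k.+2 ^+ 2 <= (d k.+1 + d k) * (c * (q k.+1 - q k.+2)).
    rewrite -(@ler_pXn2r _ 2) ?nnegrE ?addr_ge0 ?divr_ge0//.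
    apply: le_trans sq _; set X := d k.+1 + d k; set Y := c * _.
    by have := sqr_ge0 (X / 4 - Y); nra.
  have : delta * d k.+2 ^+ 2 <= 4 * (1 + E) * (d k.+1 + d k) * (q k.+1 - q k.+2).
    apply: le_trans (step _) _; rewrite -!q4.
    have conc (x y : R) : 0 <= y -> y <= x -> x ^+ 4 - y ^+ 4 <= 4 * x ^+ 3 * (x - y).
      move=> y0 yx; have x0 : 0 <= x := le_trans y0 yx.
      have -> : x ^+ 4 - y ^+ 4 = (x ^+ 3 + x ^+ 2 * y + x * y ^+ 2 + y ^+ 3) * (x - y) by ring.
      rewrite ler_wpM2r ?subr_ge0//.
      have l1 : x ^+ 2 * y <= x ^+ 3 by rewrite [leRHS]exprSr ler_wpM2l// exprn_ge0.
      have l2 : x * y ^+ 2 <= x ^+ 3 by rewrite [leRHS]exprS ler_wpM2l// lerXn2r// nnegrE.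
      have l3 : y ^+ 3 <= x ^+ 3 by rewrite lerXn2r// nnegrE.
      lra.
    apply: le_trans (conc _ _ (q0 _) (qdec _)) _; rewrite ler_wpM2r//.
    by have := q3 _ Nk; lra.
  rewrite -ler_pdivlMl// => /le_trans; apply.
  by rewrite le_eqVlt; apply/orP; left; apply/eqP; rewrite /c; ring.
(* the terms in [d] absorb the average of the two previous gaps in [main] *)
apply: (@telescoping_bound (fun k => c * q k + d k / 2 + d k.-1 / 4) N.+1).
  by move=> k; have := mulr_ge0 c0 (q0 k); have := d_ge0 k; have := d_ge0 k.-1; lra.
by case=> // k Nk /=; have := main k Nk; lra.
Qed.

(** The hypothesis is what an exponent 1/2 yields: [h] is bounded by a multiple
    of its own decrease, so it contracts, and [d ^+ 2] is bounded by [h]. *)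
Lemma geometric_decay (q : R) (N : nat) : 0 < q ->
  (forall k, (N <= k)%N -> h k.+1 <= q * (h k - h k.+1)) ->
  exists c rho, [/\ 0 < c, 0 < rho < 1 & forall k, (N <= k)%N -> d k.+1 <= c * rho ^+ k].
Proof.
move=> q0 hq; pose th := q / (1 + q).
have q1 : 0 < 1 + q by lra.
have th0 : 0 < th by rewrite divr_gt0.
have th1 : th < 1 by rewrite ltr_pdivrMr//; lra.
have contr k : (N <= k)%N -> h k.+1 <= th * h k.
  by move=> Nk; rewrite /th mulrAC ler_pdivlMr//; have := hq _ Nk; lra.
have geo j : h (N + j)%N <= h N * th ^+ j.
  elim: j => [|j IH]; first by rewrite addn0 mulr1.
  rewrite addnS exprS mulrCA; apply: le_trans (contr _ (leq_addr _ _)) _.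
  by rewrite ler_wpM2l// ltW.
pose C := (h N / th ^+ N + 1) / delta.
have C0 : 0 < C.
  by rewrite divr_gt0// ltr_wpDl// divr_ge0// exprn_ge0// ltW.
exists (Num.sqrt C), (Num.sqrt th); split.
- by rewrite sqrtr_gt0.
- by rewrite sqrtr_gt0 th0 -[ltRHS]sqrtr1 ltr_sqrt.
move=> k Nk.
rewrite -(@ler_pXn2r _ 2) ?nnegrE ?mulr_ge0 ?exprn_ge0 ?sqrtr_ge0//.
rewrite exprMn -exprM mulnC exprM (sqr_sqrtr (ltW C0)) (sqr_sqrtr (ltW th0)).
rewrite -(ler_pM2l delta_gt0) [leRHS]mulrA.
have -> : delta * C = h N / th ^+ N + 1 by rewrite /C mulrC divfK// gt_eqF.
apply: (@le_trans _ _ (h k)); first by have := step k; have := h_ge0 k.+1; lra.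
have := geo (k - N)%N; rewrite subnKC// => /le_trans; apply.
rewrite mulrDl mul1r; apply: (@le_trans _ _ (h N / th ^+ N * th ^+ k)); last first.
  by rewrite lerDl exprn_ge0// ltW.
by rewrite -{2}(subnKC Nk) exprD mulrA divfK// gt_eqF// exprn_gt0.
Qed.

End Sequences.

(** * Convergence of sequences of vectors *)

Lemma cvg_sumr {R : realType} {I : finType} (F : I -> nat -> R) (l : I -> R) :
  (forall i, F i @ \oo --> l i) ->
  (fun k => \sum_i F i k) @ \oo --> \sum_i l i.
Proof.
by move=> Fl; apply: cvg_big => //; exact: add_continuous.
Qed.

Section VectorSequences.
Context {R : realType} {n : nat}.
Implicit Types (x u v : nat -> 'cV[R]_n).

Lemma cvg_enorm_le u (l : 'cV[R]_n) (e : nat -> R) :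
  e @ \oo --> (0 : R) -> (forall k, enorm (u k - l) <= e k) -> u @ \oo --> l.
Proof.
move=> e0 he; apply/cvg_enormP.
apply: (squeeze_cvgr (f := fun=> 0) (h := e)) => //; last exact: cvg_cst.
by apply: nearW => k; rewrite enorm_ge0 he.
Qed.

Lemma finite_length_cvg x B :
  (forall M, \sum_(0 <= k < M) enorm (x k.+1 - x k) <= B) ->
  exists xs : 'cV[R]_n, x @ \oo --> xs.
Proof.
move=> hB.
have coord i : exists l : R, (fun k => x k i 0) @ \oo --> l.
  pose u k := x k.+1 i 0 - x k i 0.
  have cu : cvgn [normed series u].
    apply: nondecreasing_is_cvgn.
      apply/nondecreasing_seqP => k; rewrite /normed_series_of /series /=.
      by rewrite big_nat_recr//= lerDl.
    exists B => _ [M _ <-]; apply: le_trans (hB M); rewrite /normed_series_of /series /=.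
    by apply: ler_sum => k _; have := coord_le_enorm (x k.+1 - x k) i; rewrite !mxE.
  have /cvg_ex[l hl] := normed_cvg cu.
  exists (l + x 0%N i 0).
  have -> : (fun k => x k i 0) = (fun k => series u k + x 0%N i 0).
    apply/funext => k; rewrite /series /= (@telescope_sumr _ 0 k (fun k => x k i 0))//.
    by rewrite subrK.
  by apply: cvgD => //; exact: cvg_cst.
have /choice[l hl] := coord.
exists (\col_i l i); apply: (cvg_enorm_le (e := fun k => \sum_i `|x k i 0 - l i|)).
  rewrite -[X in _ --> X](_ : \sum_(i < n) 0 = 0 :> R); last by rewrite big1.
  apply: cvg_sumr => i; rewrite -(normr0 R) -(subrr (l i)).
  by apply: cvg_norm; apply: cvgB => //; exact: cvg_cst.
move=> k; apply: le_trans (enorm_le_sum _) _; apply: ler_sum => i _.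
by rewrite !mxE.
Qed.

Lemma cvg_dotv u v (a b : 'cV[R]_n) : u @ \oo --> a -> v @ \oo --> b ->
  (fun k => dotv (u k) (v k)) @ \oo --> dotv a b.
Proof.
have coord (w : nat -> 'cV[R]_n) (c : 'cV[R]_n) i : w @ \oo --> c -> (fun k => w k i 0) @ \oo --> c i 0.
  by move=> wc; exact: (cvg_comp _ _ wc (@coord_continuous _ _ _ i 0 c)).
move=> ua vb; rewrite /dotv.
by apply: cvg_sumr => i; apply: cvgM; exact: coord.
Qed.

(** Steps of geometric size lead to a limit at geometric speed. *)
Lemma geometric_rate x (xs : 'cV[R]_n) (c rho : R) (N : nat) :
  0 < c -> 0 < rho < 1 -> x @ \oo --> xs ->
  (forall k, (N <= k)%N -> enorm (x k.+1 - x k) <= c * rho ^+ k) ->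
  exists2 c1, 0 < c1 & \forall k \near \oo, enorm (x k - xs) <= c1 * rho ^+ k.
Proof.
move=> c0 /andP[r0 r1] /cvg_enormP/cvgrPdist_lt xc hx.
pose C := c / (1 - rho).
have r1' : 0 < 1 - rho by lra.
have C0 : 0 < C by rewrite divr_gt0.
exists C => //; exists N => // k Nk.
have tail j : enorm (x (k + j)%N - x k) <= C * (rho ^+ k - rho ^+ (k + j)).
  elim: j => [|j IH]; first by rewrite addn0 !subrr enorm0 mulr0.
  rewrite addnS -(subrK (x (k + j)%N) (x (k + j).+1)) -addrA.
  apply: le_trans (enorm_triangle _ _) _.
  have := hx _ (leq_trans Nk (leq_addr j k)).
  have -> : c = C * (1 - rho) by rewrite divfK// gt_eqF.
  rewrite exprS; lra.
apply/ler_addgt0Pr => eps eps0.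
have [M _ hM] := xc _ eps0.
have := hM (k + M)%N (leq_addl _ _); rewrite /= sub0r normrN ger0_norm ?enorm_ge0// => lt_eps.
rewrite -(subrK (x (k + M)%N) (x k)) -addrA.
apply: le_trans (enorm_triangle _ _) _; rewrite enormB; apply: lerD; last exact: ltW.
apply: le_trans (tail M) _; rewrite ler_wpM2l ?(ltW C0)// gerBl.
by rewrite exprn_ge0// ltW.
Qed.

End VectorSequences.

(** * Supports *)

Section Support.
Context {R : realType} {n : nat}.
Implicit Types (x y z v : 'cV[R]_n).

(** The support of [z] encoded as the orthogonal projector onto its coordinate
    subspace, which is how it enters the Lojasiewicz inequality. *)
Definition suppmx z : 'M[R]_n := diag_mx (\row_i (z i 0 != 0)%:R).

Lemma suppmxE z v i : (suppmx z *m v) i 0 = (z i 0 != 0)%:R * v i 0.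
Proof. by rewrite /suppmx mul_diag_mx !mxE. Qed.

Lemma suppmx_sym z : (suppmx z)^T = suppmx z.
Proof. exact: tr_diag_mx. Qed.

Lemma suppmx_id z : suppmx z *m z = z.
Proof.
apply/colP => i; rewrite suppmxE; have [->|_] := eqVneq (z i 0) 0.
  by rewrite mulr0.
by rewrite mul1r.
Qed.

Lemma suppmx_idem z v : suppmx z *m (suppmx z *m v) = suppmx z *m v.
Proof.
by apply/colP => i; rewrite !suppmxE; case: (_ != _); rewrite ?mul1r ?mul0r.
Qed.

Lemma suppmx_le z v : enorm (suppmx z *m v) <= enorm v.
Proof.
rewrite -(@ler_pXn2r _ 2) ?nnegrE ?enorm_ge0// !sqr_enorm.
apply: ler_sum => i _; rewrite !suppmxE.
by case: (_ != _); rewrite ?mul1r// !mul0r -expr2 sqr_ge0.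
Qed.

Lemma dotv_suppmx z v : dotv z (suppmx z *m v) = dotv z v.
Proof. by rewrite -[in RHS](suppmx_id z) dotv_mulmx suppmx_sym. Qed.

Lemma l0norm_suppmx z v a : (l0norm (a *: (suppmx z *m v)) <= l0norm z)%N.
Proof.
apply: subset_leq_card; apply/fintype.subsetP => i; rewrite !inE mxE suppmxE.
by apply: contraNN => /eqP->; rewrite eqxx mul0r mulr0.
Qed.

Lemma same_suppmx x y : (forall i, (x i 0 == 0) = (y i 0 == 0)) ->
  suppmx x = suppmx y /\ l0norm x = l0norm y.
Proof.
move=> h; split; first by congr diag_mx; apply/rowP => i; rewrite !mxE h.
by apply: eq_card => i; rewrite !inE h.
Qed.

(** An entry that is zero in only one of the vectors moves by at least [kappa]. *)
Lemma same_support_close (kappa : R) x y :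
  (forall i, x i 0 != 0 -> kappa <= `|x i 0|) ->
  (forall i, y i 0 != 0 -> kappa <= `|y i 0|) ->
  enorm (x - y) < kappa -> forall i, (x i 0 == 0) = (y i 0 == 0).
Proof.
move=> hx hy hxy i; have := le_lt_trans (coord_le_enorm (x - y) i) hxy; rewrite !mxE.
have [x0|x0] := eqVneq (x i 0) 0; have [y0|y0] := eqVneq (y i 0) 0 => //.
- by rewrite x0 sub0r normrN ltNge hy.
- by rewrite y0 subr0 ltNge hx.
Qed.

(** The nonzero entries of [x] persist nearby, so that a vector near [x] has the
    support of [x] as soon as it has no more nonzero entries. *)
Lemma l0norm_near x : exists2 e, 0 < e & forall z, enorm (z - x) < e ->
  (forall i, x i 0 != 0 -> z i 0 != 0) /\
  (l0norm z = l0norm x -> forall i, (z i 0 == 0) = (x i 0 == 0)).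
Proof.
pose k i := `|x i 0|^-1.
have k0 i : 0 <= k i by rewrite invr_ge0.
have S0 : 0 <= \sum_i k i by apply: sumr_ge0.
have sum0 : 0 < (\sum_i k i) + 1 by lra.
exists ((\sum_i k i) + 1)^-1; first by rewrite invr_gt0.
move=> z zx.
have sub i : x i 0 != 0 -> z i 0 != 0.
  move=> xi; apply/eqP => zi.
  have := le_lt_trans (coord_le_enorm (z - x) i) zx; rewrite !mxE zi sub0r normrN.
  have a0 : 0 < `|x i 0| by rewrite normr_gt0.
  apply/negP; rewrite -leNgt -[leRHS]invrK lef_pV2 ?posrE ?invr_gt0//.
  by rewrite (bigD1 i)//= -addrA lerDl addr_ge0// sumr_ge0.
split=> // zl i.
have ss : [pred i | x i 0 != 0] \subset [pred i | z i 0 != 0].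
  by apply/fintype.subsetP => j; rewrite !inE; exact: sub.
have /fintype.subset_cardP : l0norm x = l0norm z by [].
move=> /(_ ss) /(_ i); rewrite !inE => /(congr1 negb).
by rewrite !negbK.
Qed.

End Support.

(** * The proximal step on the sphere *)

Section Prox.
Context {R : realType} {n : nat}.
Variables (lambda tau : R).
Hypotheses (lambda_gt0 : 0 < lambda) (tau_gt0 : 0 < tau).
Implicit Types (x y z v : 'cV[R]_n).

Lemma reg_sphere x : enorm x = 1 -> reg lambda x = (lambda * (l0norm x)%:R)%:E.
Proof.
by move=> x1; rewrite /reg /delta_set mem_set// add0e.
Qed.

Lemma reg_off_sphere x : enorm x != 1 -> reg lambda x = +oo%E.
Proof.
by move=> x1; rewrite /reg /delta_set memNset//; exact/eqP.
Qed.

(** On the sphere [|z - y|^2] is [- 2 <z, y>] up to a constant.  The unit vector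
    [w] ensures that the minimum is finite. *)
Lemma prox_regP y z (w : 'cV[R]_n) : enorm w = 1 ->
  prox tau (reg lambda) y z <->
  enorm z = 1 /\ forall z', enorm z' = 1 ->
    lambda * tau * (l0norm z)%:R - dotv z y <= lambda * tau * (l0norm z')%:R - dotv z' y.
Proof.
move=> w1.
have cmp u v : enorm u = 1 -> enorm v = 1 ->
  ((2 * tau)^-1 * enorm (u - y) ^+ 2 + lambda * (l0norm u)%:R <=
   (2 * tau)^-1 * enorm (v - y) ^+ 2 + lambda * (l0norm v)%:R) =
  (lambda * tau * (l0norm u)%:R - dotv u y <= lambda * tau * (l0norm v)%:R - dotv v y).
  move=> u1 v1; rewrite !sqr_enormB u1 v1 -(ler_pM2l tau_gt0).
  rewrite -subr_ge0 -[RHS]subr_ge0; congr (0 <= _); field.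
  by rewrite gt_eqF.
have fin u : enorm u = 1 ->
  ((((2 * tau)^-1 * enorm (u - y) ^+ 2)%:E + reg lambda u)%E =
   ((2 * tau)^-1 * enorm (u - y) ^+ 2 + lambda * (l0norm u)%:R)%:E).
  by move=> u1; rewrite reg_sphere.
split.
- move=> /= h.
  have z1 : enorm z = 1.
    apply/eqP/negPn/negP => /reg_off_sphere zoo; have := h w.
    by rewrite (fin w w1) zoo addey// leye_eq.
  by split=> // z' z'1; rewrite -cmp//; have := h z'; rewrite !fin// lee_fin.
- move=> [z1 h] z' /=; rewrite fin//.
  have [z'1|z'1] := eqVneq (enorm z') 1; last first.
    by rewrite reg_off_sphere// addey// leey.
  by rewrite fin// lee_fin cmp// h.
Qed.

Section Minimizer.
Variables (y z : 'cV[R]_n).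
Hypothesis zP : prox tau (reg lambda) y z.
Hypothesis z1 : enorm z = 1.

Let zmin z' : enorm z' = 1 ->
    lambda * tau * (l0norm z)%:R - dotv z y <= lambda * tau * (l0norm z')%:R - dotv z' y.
Proof. by have /(prox_regP _ _ z1)[_ /(_ z')] := zP. Qed.

(** Among unit vectors supported in the support of [z], the point [z] maximizes
    the inner product with [y]; hence [y] restricted to that support is normal
    to the sphere at [z]. *)
Lemma prox_normal : tangent z (suppmx z *m y) = 0.
Proof.
set v := suppmx z *m y.
have [v0|v0] := eqVneq v 0.
  by rewrite /tangent v0 dotv0 scale0r subr0.
have nv : 0 < enorm v by rewrite enorm_gt0.
have /zmin : enorm ((enorm v)^-1 *: v) = 1.
  by rewrite enormZ ger0_norm ?invr_ge0 ?enorm_ge0// mulVf// gt_eqF.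
have lz : lambda * tau * (l0norm ((enorm v)^-1 *: v))%:R <= lambda * tau * (l0norm z)%:R.
  by apply: ler_wpM2l; [rewrite mulr_ge0 ?ltW | rewrite ler_nat l0norm_suppmx].
move=> h; have {h lz} : dotv ((enorm v)^-1 *: v) y <= dotv z v.
  by rewrite dotv_suppmx; lra.
have vy : dotv v y = enorm v ^+ 2.
  have -> : enorm v ^+ 2 = dotv y (suppmx z *m v).
    by rewrite sqr_enorm {1}/v dotv_mulmx suppmx_sym.
  by rewrite /v suppmx_idem dotvC.
rewrite dotvZl vy expr2 mulKf ?gt_eqF// => h.
apply/eqP; rewrite -enorm_eq0 -sqrf_eq0 eq_le sqr_ge0 andbT.
rewrite sqr_enormB dotvZr (dotvC v) enormZ z1 mulr1 -[`|_| ^+ 2]normrX ger0_norm ?sqr_ge0//.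
have : enorm v ^+ 2 <= dotv z v ^+ 2.
  by rewrite lerXn2r// nnegrE ?(ltW nv)//; exact: le_trans (ltW nv) h.
lra.
Qed.

(** Deleting a small entry of [z] and renormalizing would save [lambda] at
    negligible cost. *)
Lemma prox_entries Y i : enorm y <= Y -> z i 0 != 0 ->
  Num.min 1 (lambda * tau / (2 * (Y + 1))) <= `|z i 0|.
Proof.
move=> yY zi0; have Y0 : 0 <= Y := le_trans (enorm_ge0 _) yY.
rewrite ge_min; have [//|zi1] := leP 1 `|z i 0| => /=.
set t := z i 0 in zi0 zi1 *.
have t2 : t ^+ 2 < 1.
  by rewrite -[t ^+ 2]ger0_norm ?sqr_ge0// normrX exprn_ilt1.
pose s := Num.sqrt (1 - t ^+ 2).
have s0 : 0 < s by rewrite sqrtr_gt0 subr_gt0.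
have s2 : s ^+ 2 = 1 - t ^+ 2 by rewrite sqr_sqrtr// subr_ge0 ltW.
pose w := z - t *: delta_mx i 0.
have wE : enorm w = s.
  apply/eqP; rewrite -(@eqrXn2 _ 2) ?enorm_ge0 ?(ltW s0)// s2 sqr_enormB z1.
  rewrite dotvZr dotv_delta -/t enormZ enorm_delta mulr1 -normrX ger0_norm ?sqr_ge0//.
  by apply/eqP; ring.
have zw : dotv z w = s ^+ 2.
  by rewrite dotvBr dotvZr dotv_delta -sqr_enorm z1 s2 expr1n expr2.
have lw : (l0norm (s^-1 *: w)).+1 = l0norm z.
  rewrite /l0norm [RHS](cardD1 i) inE zi0 add1n; congr _.+1.
  apply: eq_card => j; rewrite !inE !mxE eqxx andbT mulf_eq0 negb_or invr_eq0 gt_eqF//=.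
  have [->|ji] := eqVneq j i; first by rewrite mulr1 subrr eqxx.
  by rewrite mulr0 subr0.
have /zmin : enorm (s^-1 *: w) = 1.
  by rewrite enormZ wE ger0_norm ?invr_ge0 ?(ltW s0)// mulVf// gt_eqF.
rewrite -lw -natr1 => h.
have : lambda * tau <= dotv (z - s^-1 *: w) y by rewrite dotvBl; lra.
move=> /le_trans/(_ (dotv_le _ _)) {}h.
have dist : enorm (z - s^-1 *: w) <= 2 * `|t|.
  rewrite -(@ler_pXn2r _ 2) ?nnegrE ?enorm_ge0 ?mulr_ge0// sqr_enormB z1.
  rewrite dotvZr zw expr2 mulKf ?gt_eqF// enormZ wE ger0_norm ?invr_ge0 ?(ltW s0)//.
  rewrite mulVf ?gt_eqF// exprMn -normrX ger0_norm ?sqr_ge0//.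
  have s1 : s <= 1 by rewrite -[leRHS]sqrtr1 ler_sqrt// lerBlDr lerDl sqr_ge0.
  have := sqr_ge0 t; nra.
rewrite ler_pdivrMr; last by lra.
apply: le_trans h _.
apply: (@le_trans _ _ (2 * `|t| * Y)).
  by apply: ler_pM; rewrite ?enorm_ge0.
by have := normr_ge0 t; nra.
Qed.

End Minimizer.

End Prox.

(** * Subgradients of the objective *)

Section Subdifferential.
Context {R : realType} {m n : nat}.
Variables (A : 'M[R]_(m, n)) (lambda sigma gamma C : R).
Let f := loss A sigma gamma.
Let G := grad f.
Hypotheses (lambda_gt0 : 0 < lambda) (C_ge0 : 0 <= C).
Hypothesis f_taylor : forall x v, `|f (x + v) - f x - dotv (G x) v| <= C * enorm v ^+ 2.
Let F := objective A lambda sigma gamma.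
Implicit Types x y z : 'cV[R]_n.

Let F_sphere x : enorm x = 1 -> F x = (f x + lambda * (l0norm x)%:R)%:E.
Proof. by move=> x1; rewrite /F /objective /delta_set mem_set// adde0. Qed.

Let F_off_sphere x : enorm x != 1 -> F x = +oo%E.
Proof.
by move=> x1; rewrite /F /objective /delta_set memNset//; exact/eqP.
Qed.

Let subgrad x := tangent x (suppmx x *m G x).

(** First-order behaviour of the objective around a point of the sphere: off the
    support of [x] the jump of the counting term wins, and on it the
    displacement is tangent to the sphere up to second order. *)
Let F_growth x eps : enorm x = 1 -> 0 < eps -> exists2 delta, 0 < delta &
  forall z, enorm z = 1 -> enorm (z - x) < delta ->
    - (eps * enorm (z - x)) <=
    f z + lambda * (l0norm z)%:R - (f x + lambda * (l0norm x)%:R) - dotv (subgrad x) (z - x).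
Proof.
move=> x1 eps0; have [e e0 he] := l0norm_near x.
set w := subgrad x; pose mu := dotv x (suppmx x *m G x).
pose k1 := C + `|mu| + 1; pose k2 := enorm (G x) + C + enorm w + 1.
have k10 : 0 < k1 by rewrite /k1; have := normr_ge0 mu; have := C_ge0; lra.
have k20 : 0 < k2.
  by rewrite /k2; have := enorm_ge0 (G x); have := enorm_ge0 w; have := C_ge0; lra.
exists (Num.min (Num.min 1 e) (Num.min (eps / k1) (lambda / k2))).
  by rewrite !lt_min ltr01 e0 !divr_gt0.
move=> z z1; rewrite !lt_min !ltr_pdivlMr// => /andP[/andP[v1 ve] /andP[vk1 vk2]].
have [sub same] := he _ ve.
have tay := f_taylor x (z - x); rewrite [x + _]addrC subrK in tay.
set u := z - x in tay v1 ve vk1 vk2 *; have v0 := enorm_ge0 u.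
move: tay; rewrite ler_norml => /andP[tay _].
have [l0|l0] := eqVneq (l0norm z) (l0norm x).
- have Su : suppmx x *m u = u.
    apply/colP => i; rewrite suppmxE !mxE.
    have [x0|_] := eqVneq (x i 0) 0; last by rewrite mul1r.
    by have := same l0 i; rewrite x0 eqxx => /eqP ->; rewrite subrr mulr0.
  have Gu : dotv (G x) u = dotv w u + mu * dotv x u.
    by rewrite /w /subgrad /tangent dotvBl dotvZl subrK dotv_mulmx suppmx_sym Su.
  have xu : dotv x u = - (enorm u ^+ 2 / 2).
    have := sqr_enormB z x; have := sqr_enorm x; rewrite -/u z1 x1 /u dotvBr (dotvC x z); lra.
  rewrite l0; rewrite Gu xu in tay.
  have b1 : mu * (enorm u ^+ 2 / 2) <= `|mu| * enorm u ^+ 2.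
    have := ler_wpM2r (sqr_ge0 (enorm u)) (ler_norm mu).
    have := mulr_ge0 (normr_ge0 mu) (sqr_ge0 (enorm u)); lra.
  have b2 : k1 * enorm u ^+ 2 <= eps * enorm u.
    by rewrite expr2 mulrA ler_wpM2r// mulrC ltW.
  have := sqr_ge0 (enorm u); rewrite /k1 in b2; lra.
- have l1 : (l0norm x)%:R + 1 <= (l0norm z)%:R :> R.
    rewrite natr1 ler_nat ltn_neqAle eq_sym l0 /=; apply: subset_leq_card.
    by apply/fintype.subsetP => i; rewrite !inE; exact: sub.
  have := ler_wpM2l (ltW lambda_gt0) l1.
  have := cauchy_schwarz (G x) u; rewrite ler_norml => /andP[c1 _].
  have := dotv_le w u => c2.
  have : C * enorm u ^+ 2 <= C * enorm u.
    by rewrite ler_wpM2l// expr2 ler_piMr// ltW.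
  have := mulr_ge0 (ltW eps0) v0; rewrite /k2 in vk2; lra.
Qed.

Lemma tangent_regular_subgradient x : enorm x = 1 -> regular_subdiff F x (subgrad x).
Proof.
move=> x1; split; first by rewrite F_sphere.
rewrite limf_einfE; apply/lee_addgt0Pr => eps eps0.
have [delta delta0 hd] := F_growth x1 eps0.
rewrite -leeBlDr// sub0e.
apply: (@le_trans _ _ (ereal_inf ((fun z => ((F z - F x - (dotv (subgrad x) (z - x))%:E)
    * ((enorm (z - x))^-1)%:E)%E) @` [set z | z != x /\ enorm (z - x) < delta]))).
  apply/ereal_infP => _ [z [zx zd] <-]; rewrite (F_sphere x1).
  have v0 : 0 < enorm (z - x) by rewrite enorm_gt0 subr_eq0.
  have [z1|z1] := eqVneq (enorm z) 1; last first.
    by rewrite F_off_sphere// !addye// gt0_mulye ?leey// lte_fin invr_gt0.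
  rewrite F_sphere// -!EFinB -EFinM lee_fin ler_pdivlMr// mulNr.
  exact: hd.
apply: ereal_sup_ubound; exists [set z | z != x /\ enorm (z - x) < delta] => //.
by apply/nbhs_enormP; exists delta => // y yd /= yx; split.
Qed.

Lemma tangent_limiting_subgradient x : enorm x = 1 -> limiting_subdiff F x (subgrad x).
Proof.
move=> x1; have reg := tangent_regular_subgradient x1; split; first by case: reg.
by exists (fun=> x), (fun=> subgrad x); split => //; exact: cvg_cst.
Qed.

(** The distance of the subdifferential to the origin is at most the norm of the
    tangential subgradient, and [sqrt] desingularizes an exponent 1/2. *)
Lemma KL_half_quadratic xs : enorm xs = 1 -> KL_at F (1 / 2) xs ->
  exists E e : R, [/\ 0 <= E, 0 < e &
  forall y, enorm y = 1 -> enorm (y - xs) < e -> l0norm y = l0norm xs ->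
     f xs < f y -> f y < f xs + e ->
     f y - f xs <= E * enorm (tangent y (suppmx y *m G y)) ^+ 2].
Proof.
move=> xs1 [eta [U [c [eta0 /nbhs_enormP[e2 e20 hU] c0 kl]]]].
have [e1 e10 he1] : exists2 e1 : R, 0 < e1 & (e1%:E <= eta)%E.
  case: eta eta0 {kl} => [r|_|//]; first by rewrite lte_fin; exists r.
  by exists 1; rewrite ?leey.
exists ((c / 2) ^+ 2), (Num.min e1 e2); split; first exact: sqr_ge0.
  by rewrite lt_min e10.
move=> y y1; rewrite lt_min => /andP[_ yU] l0 flt fe.
have {}fe : f y < f xs + e1 by apply: lt_le_trans fe _; rewrite lerD2l ge_min lexx.
have := kl y (hU _ yU).
rewrite !F_sphere// l0 lte_fin ltrD2r flt -EFinB /=.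
have -> : f y + lambda * (l0norm xs)%:R - (f xs + lambda * (l0norm xs)%:R) = f y - f xs by ring.
set s := f y - f xs; have s0 : 0 < s by rewrite subr_gt0.
have -> : ((f y + lambda * (l0norm xs)%:R)%:E < (f xs + lambda * (l0norm xs)%:R)%:E + eta)%E.
  apply: lt_le_trans (leeD2l _ he1); rewrite -EFinD lte_fin; lra.
move=> /(_ isT) h1.
set rho := enorm (tangent y (suppmx y *m G y)).
have r0 : 0 <= rho by exact: enorm_ge0.
have sq0 : 0 < Num.sqrt s by rewrite sqrtr_gt0.
have der : derive1 (fun t => c * t `^ (1 - 1 / 2)) s = c / 2 * (Num.sqrt s)^-1.
  have D := is_derive1_powR (1 - 1 / 2) s0.
  have DM : is_derive s (1 : R) (fun t => c * t `^ (1 - 1 / 2))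
      (c * ((1 - 1 / 2) * s `^ (1 - 1 / 2 - 1))) by exact: is_deriveZ.
  rewrite derive1E (@derive_val _ _ _ _ _ _ _ DM).
  have -> : 1 - 1 / 2 - 1 = - 2^-1 :> R by field.
  by rewrite powRN powR12_sqrt ?(ltW s0)//; field; rewrite gt_eqF.
have : (1 <= (c / 2 * (Num.sqrt s)^-1 * rho)%:E)%E.
  apply: le_trans h1 _; rewrite der [in leRHS]EFinM lee_wpmul2l//.
    by rewrite lee_fin mulr_ge0 ?divr_ge0 ?invr_ge0 ?(ltW c0) ?(ltW sq0).
  apply: ereal_inf_lbound; exists (subgrad y) => //.
  exact: tangent_limiting_subgradient.
rewrite lee_fin mulrAC ler_pdivlMr// mul1r => h2.
rewrite -exprMn -[leLHS](sqr_sqrtr (ltW s0)).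
by rewrite lerXn2r ?nnegrE ?(ltW sq0)// mulr_ge0// divr_ge0// ltW.
Qed.

End Subdifferential.

(** * The extrapolated proximal iteration *)

Lemma near_oo_pred (Q : nat -> Prop) :
  (\forall k \near \oo, Q k.+1) -> \forall k \near \oo, Q k.
Proof. by case=> N _ hN; exists N.+1 => // -[//|k] Nk; exact: hN. Qed.

Section Algorithm.
Context {R : realType} {n : nat}.
Variables (f : 'cV[R]_n -> R) (G : 'cV[R]_n -> 'cV[R]_n).
Variables (L lambda tau vs bm : R) (beta : nat -> R) (x : nat -> 'cV[R]_n).
Hypotheses (L_ge0 : 0 <= L)
  (G_lip : forall y z, enorm (G y - G z) <= L * enorm (y - z))
  (f_taylor : forall y v, `|f (y + v) - f y - dotv (G y) v| <= L / 2 * enorm v ^+ 2)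
  (f_loj : forall (P : 'M[R]_n) (fs : R), P^T = P ->
    exists2 K, 0 < K & forall x, enorm x = 1 -> P *m x = x ->
      K * `|f x - fs| <= 1 -> K * enorm (tangent x (P *m G x)) <= 1 ->
      `|f x - fs| ^+ 3 <= K * enorm (tangent x (P *m G x)) ^+ 4).
Hypotheses (lambda_gt0 : 0 < lambda) (tau_gt0 : 0 < tau)
  (vs_gt0 : 0 < vs) (vs_lt1 : vs < 1) (tauL : L < tau^-1)
  (bm_le : bm <= Num.sqrt (vs * (tau^-1 - L) * tau^-1) / (2 * (tau^-1 + L)))
  (beta_range : forall k, 0 <= beta k <= bm).
Hypotheses (x0_unit : enorm (x 0%N) = 1)
  (x_step : forall k, prox tau (reg lambda)
     (extrapolation beta x k - tau *: G (extrapolation beta x k)) (x k.+1)).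

Let p := tau^-1.
Let xt := extrapolation beta x.

Let p_gt0 : 0 < p. Proof. by rewrite invr_gt0. Qed.

Let bm_ge0 : 0 <= bm.
Proof. by have /andP[] := beta_range 0; exact: le_trans. Qed.

Let x_unit k : enorm (x k) = 1.
Proof. by case: k => // k; have /(prox_regP _ tau_gt0 _ _ x0_unit)[] := x_step k. Qed.

(** Since [0.-1 = 0], the gap of index [0] vanishes, in accordance with the
    convention that the iterations start from two equal points. *)
Definition gap k := enorm (x k - x k.-1).
Local Notation d := gap.

Let d_ge0 k : 0 <= d k. Proof. exact: enorm_ge0. Qed.

Let d_le2 k : d k <= 2.
Proof.
by apply: le_trans (enorm_triangleB _ _) _; rewrite !x_unit.
Qed.

Let xt_dist k : enorm (xt k - x k) = beta k * d k.
Proof.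
have /andP[b0 _] := beta_range k.
by rewrite /xt /extrapolation addrC addKr enormZ ger0_norm.
Qed.

(** This is how the bound on the extrapolation parameters is used. *)
Let beta_sqr k : p * beta k ^+ 2 <= vs * (p - L) / 4.
Proof.
have /andP[b0 bb] := beta_range k.
have pL : 0 < p + L by have := p_gt0; have := L_ge0; lra.
have pmL : 0 < p - L by rewrite subr_gt0.
have : beta k * (2 * (p + L)) <= Num.sqrt (vs * (p - L) * p).
  by rewrite -ler_pdivlMr ?mulr_gt0//; exact: le_trans bb bm_le.
rewrite -(@ler_pXn2r _ 2) ?nnegrE ?mulr_ge0 ?sqrtr_ge0 ?(ltW pL)//.
rewrite sqr_sqrtr; last by rewrite !mulr_ge0 ?(ltW vs_gt0) ?(ltW pmL) ?(ltW p_gt0).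
rewrite -(ler_pM2l p_gt0) => h.
have pL2 : 0 < (p + L) ^+ 2 by rewrite exprn_gt0.
rewrite -(ler_pM2r pL2).
apply: (@le_trans _ _ (vs * (p - L) / 4 * p ^+ 2)); first by lra.
rewrite ler_wpM2l ?divr_ge0 ?mulr_ge0 ?(ltW vs_gt0) ?(ltW pmL)//.
by rewrite lerXn2r ?nnegrE ?(ltW p_gt0) ?(ltW pL)// lerDl.
Qed.

Let Phi k := f (x k) + lambda * (l0norm (x k))%:R.

(** The descent lemma is applied twice at the extrapolated point, towards
    [x k.+1] and towards [x k], since [f] is not convex. *)
Let descent k :
  Phi k.+1 + (p - L) / 4 * d k.+1 ^+ 2 <= Phi k + vs * (p - L) / 4 * d k ^+ 2.
Proof.
have /(prox_regP _ tau_gt0 _ _ x0_unit)[_ /(_ _ (x_unit k))] := x_step k.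
rewrite -/(xt k); set g := G (xt k) => hp.
pose D := x k.+1 - x k; pose e := xt k - x k.
have e2 : p * enorm e ^+ 2 <= vs * (p - L) / 4 * d k ^+ 2.
  by rewrite /e xt_dist exprMn mulrA ler_wpM2r ?sqr_ge0.
have DE : enorm D = d k.+1 by [].
have Dx : dotv D (x k) = - (enorm D ^+ 2 / 2).
  have := sqr_enorm (x k.+1); have := sqr_enorm (x k); rewrite !x_unit.
  by rewrite sqr_enorm /D !dotv_lin (dotvC (x k)); lra.
have h1 : lambda * (l0norm (x k.+1))%:R + dotv g D <=
    lambda * (l0norm (x k))%:R + p * (dotv D e - enorm D ^+ 2 / 2).
  rewrite -(ler_pM2l tau_gt0) [leRHS]mulrDr mulrA [tau * (p * _)]mulrA divff ?gt_eqF// mul1r.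
  have Dxt : dotv D (xt k) = dotv D e - enorm D ^+ 2 / 2.
    by rewrite -Dx -dotvDr subrK.
  rewrite -Dxt (dotvC g) /D !dotvBl; move: hp; rewrite !dotvBr !dotvZr; lra.
have h2 : f (x k.+1) - f (x k) <= dotv g D + L / 2 * (enorm (D - e) ^+ 2 + enorm e ^+ 2).
  have := f_taylor (xt k) (D - e); have := f_taylor (xt k) (- e).
  have -> : xt k + - e = x k by rewrite /e opprB addrC subrK.
  have -> : xt k + (D - e) = x k.+1.
    by rewrite /D /e; apply/colP => i; rewrite !mxE; ring.
  rewrite !ler_norml enormN dotvNr dotvBr -/g => /andP[t1 _] /andP[_ t2]; lra.
rewrite sqr_enormB in h2.
have De : dotv D e <= enorm D ^+ 2 / 4 + enorm e ^+ 2.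
  by apply: le_trans (dotv_le _ _) _; have := sqr_ge0 (enorm D / 2 - enorm e); lra.
have pmL : 0 <= p - L by rewrite subr_ge0 ltW.
have := ler_wpM2l pmL De; rewrite -DE /Phi; lra.
Qed.

(** Any weight strictly between the two coefficients of [descent] makes both of
    the gaps contribute to the decrease; this is the midpoint. *)
Let a := (1 + vs) * (p - L) / 8.
Let delta := (1 - vs) * (p - L) / 8.

Let a_ge0 : 0 <= a.
Proof. by rewrite divr_ge0// mulr_ge0 ?subr_ge0 ?(ltW tauL)//; have := vs_gt0; lra. Qed.

Let delta_gt0 : 0 < delta.
Proof. by rewrite divr_gt0// mulr_gt0 ?subr_gt0. Qed.

Let H k := Phi k + a * d k ^+ 2.

Let H_decrease k : H k.+1 + delta * (d k.+1 ^+ 2 + d k ^+ 2) <= H k.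
Proof. by have := descent k; rewrite /H /a /delta; lra. Qed.

Let H_lb : exists B, forall k, B <= H k.
Proof.
exists (f 0 - enorm (G 0) - L / 2) => k.
have := f_taylor 0 (x k); rewrite add0r x_unit ler_norml => /andP[h1 _].
have := cauchy_schwarz (G 0) (x k); rewrite x_unit mulr1 ler_norml => /andP[h2 _].
have h3 : 0 <= lambda * (l0norm (x k))%:R by rewrite mulr_ge0// ltW.
have h4 : 0 <= a * d k ^+ 2 by rewrite mulr_ge0 ?sqr_ge0.
by rewrite /H /Phi; lra.
Qed.

Let H_noninc : nonincreasing_seq H.
Proof.
apply/nonincreasing_seqP => k; have := H_decrease k.
have := mulr_ge0 (ltW delta_gt0) (addr_ge0 (sqr_ge0 (d k.+1)) (sqr_ge0 (d k))); lra.
Qed.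

Let H_cvg : cvgn H.
Proof.
apply: nonincreasing_is_cvgn => //; have [B hB] := H_lb.
by exists B => _ [k _ <-].
Qed.

Let Hs := limn H.

Definition excess k := H k - Hs.
Local Notation h := excess.

Let h_ge0 k : 0 <= h k.
Proof. by rewrite subr_ge0; exact: nonincreasing_cvgn_ge. Qed.

Let h_decrease k : h k.+1 + delta * (d k.+1 ^+ 2 + d k ^+ 2) <= h k.
Proof. by have := H_decrease k; rewrite /h; lra. Qed.

Let h_cvg0 e : 0 < e -> \forall k \near \oo, h k < e.
Proof.
move=> e0; have /cvgrPdist_lt/(_ e e0) := H_cvg.
by apply: filterS => k; rewrite distrC ger0_norm// h_ge0.
Qed.

Let d_cvg0 e : 0 < e -> \forall k \near \oo, d k < e.
Proof.
move=> e0; apply: near_oo_pred.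
have /h_cvg0 : 0 < delta * e ^+ 2 by rewrite mulr_gt0// exprn_gt0.
apply: filterS => k hk.
rewrite -(@ltr_pXn2r _ 2) ?nnegrE ?(ltW e0)// -(ltr_pM2l delta_gt0).
apply: le_lt_trans hk; have := h_decrease k; have := h_ge0 k.+1.
by have := mulr_ge0 (ltW delta_gt0) (sqr_ge0 (d k)); lra.
Qed.

(** The argument of the proximal step is normal to the sphere along the support
    ([prox_normal]), so the tangential gradient at [x k.+1] only sees the
    displacement from the extrapolated point. *)
Let residual k : enorm (tangent (x k.+1) (suppmx (x k.+1) *m G (x k.+1))) <=
  (L + p) * (1 + bm) * (d k.+1 + d k).
Proof.
set z := x k.+1; set S := suppmx z.
have z1 : enorm z = 1 by exact: x_unit.
have nrm := prox_normal lambda_gt0 tau_gt0 (x_step k) z1.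
have dist : enorm (z - xt k) <= d k.+1 + bm * d k.
  have -> : z - xt k = (z - x k) - (xt k - x k).
    by apply/colP => i; rewrite !mxE; ring.
  apply: le_trans (enorm_triangleB _ _) _; rewrite xt_dist lerD2l.
  by rewrite ler_wpM2r//; have /andP[] := beta_range k.
set y := _ - _ in nrm.
have -> : tangent z (S *m G z) = tangent z (S *m ((G z - G (xt k)) + p *: (xt k - z))).
  have gE : G z = (G z - G (xt k) + p *: (xt k - z)) + (p *: z - p *: y).
    by apply/colP => i; rewrite !mxE -/p; rewrite /p; field; rewrite gt_eqF.
  rewrite [in LHS]gE mulmxDr tangentD mulmxBr -!scalemxAr suppmx_id tangentB tangent_self// sub0r.
  have -> : tangent z (p *: (S *m y)) = p *: tangent z (S *m y).
    by rewrite /tangent dotvZr scalerBr scalerA.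
  by rewrite nrm scaler0 oppr0 addr0.
apply: le_trans (tangent_le _ z1) _; apply: le_trans (suppmx_le _ _) _.
apply: le_trans (enorm_triangle _ _) _.
rewrite enormZ (gtr0_norm p_gt0) (enormB (xt k)).
apply: (@le_trans _ _ ((L + p) * (d k.+1 + bm * d k))).
  rewrite mulrDl; apply: lerD; last by rewrite ler_wpM2l ?(ltW p_gt0).
  by apply: le_trans (G_lip _ _) _; rewrite ler_wpM2l.
rewrite -mulrA ler_wpM2l ?addr_ge0 ?(ltW p_gt0)//.
by have := mulr_ge0 bm_ge0 (d_ge0 k.+1); have := d_ge0 k; lra.
Qed.

Let y_bounded : exists Y, forall k, enorm (xt k - tau *: G (xt k)) <= Y.
Proof.
exists (1 + 2 * bm + tau * (enorm (G 0) + L * (1 + 2 * bm))) => k.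
have xt_le : enorm (xt k) <= 1 + 2 * bm.
  rewrite -(subrK (x k) (xt k)); apply: le_trans (enorm_triangle _ _) _.
  rewrite x_unit xt_dist addrC lerD2l mulrC; have /andP[b0 bb] := beta_range k.
  exact: ler_pM.
apply: le_trans (enorm_triangleB _ _) _; apply: lerD => //.
rewrite enormZ (gtr0_norm tau_gt0) ler_wpM2l ?(ltW tau_gt0)//.
rewrite -(subrK (G 0) (G (xt k))) addrC; apply: le_trans (enorm_triangle _ _) _.
rewrite lerD2l; apply: le_trans (G_lip _ _) _.
by rewrite subr0 ler_wpM2l.
Qed.

Let entries : exists2 kappa, 0 < kappa &
  forall k i, x k.+1 i 0 != 0 -> kappa <= `|x k.+1 i 0|.
Proof.
have [Y hY] := y_bounded; have Y0 : 0 <= Y := le_trans (enorm_ge0 _) (hY 0).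
exists (Num.min 1 (lambda * tau / (2 * (Y + 1)))).
  by rewrite lt_min ltr01 divr_gt0 ?mulr_gt0//; lra.
by move=> k i; exact: (prox_entries tau_gt0 (x_step k) (x_unit k.+1) (hY k)).
Qed.

Let same_zeros y z := forall i : 'I_n, (y i (0 : 'I_1) == 0 :> R) = (z i (0 : 'I_1) == 0 :> R).

Let support_stable : exists N, forall k, (N <= k)%N -> same_zeros (x k) (x N).
Proof.
have [kappa kappa0 hk] := entries.
have [N _ hN] := d_cvg0 kappa0.
exists N.+1; elim=> // k IH; rewrite leq_eqVlt => /predU1P[<- //|].
rewrite ltnS => Nk i; rewrite -(IH Nk).
case: k Nk {IH} => // k Nk.
apply: (same_support_close (hk k.+1) (hk k)).
by apply: (hN k.+2); exact: leq_trans (ltnW Nk) (leqnSn _).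
Qed.

(** The Lojasiewicz inequality of [f] along the sequence, transferred from the
    value of [f] to the excess [h] and from the residual to the gaps. *)
Let excess_loj : exists E N, 0 <= E /\
  forall k, (N <= k)%N -> h k.+1 ^+ 3 <= E * (d k.+1 + d k) ^+ 4.
Proof.
have [N hN] := support_stable.
have suppE k : (N <= k)%N -> suppmx (x k) = suppmx (x N) /\ l0norm (x k) = l0norm (x N).
  by move=> Nk; apply: same_suppmx; exact: hN.
pose fs := Hs - lambda * (l0norm (x N))%:R.
have fE k : (N <= k)%N -> f (x k) - fs = h k - a * d k ^+ 2.
  by move=> Nk; rewrite /h /H /Phi /fs (suppE k Nk).2; ring.
have [K K0 hK] := f_loj fs (suppmx_sym (x N)).
pose D := (L + p) * (1 + bm).
have D0 : 0 <= D by rewrite mulr_ge0 ?addr_ge0 ?(ltW p_gt0).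
have K1 : 0 < K^-1 / 2 by rewrite divr_gt0// invr_gt0.
have K2 : 0 < K^-1 / (2 * D + 2) by rewrite divr_gt0 ?invr_gt0//; lra.
have K3 : 0 < K^-1 / (4 * a + 2) by rewrite divr_gt0 ?invr_gt0//; have := a_ge0; lra.
have [M _ hM] : \forall k \near \oo, h k < K^-1 / 2 /\
    (d k < K^-1 / (2 * D + 2) /\ d k < K^-1 / (4 * a + 2)).
  by apply: filterI (h_cvg0 K1) (filterI (d_cvg0 K2) (d_cvg0 K3)).
pose E := 4 * (K * D ^+ 4 + 4 * a ^+ 3).
have E0 : 0 <= E.
  exact: mulr_ge0 (ler0n _ _) (addr_ge0 (mulr_ge0 (ltW K0) (exprn_ge0 4 D0))
    (mulr_ge0 (ler0n _ 4) (exprn_ge0 3 a_ge0))).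
exists E, (maxn N M); split => // k; rewrite geq_max => /andP[Nk Mk].
have Nk1 : (N <= k.+1)%N by exact: leq_trans Nk (leqnSn _).
have [_ [dk _]] := hM _ Mk.
have [hk1 [dk1 dk1']] := hM _ (leq_trans Mk (leqnSn _)).
have res := residual k; rewrite (suppE _ Nk1).1 -/D in res.
set r := enorm _ in res.
have r0 : 0 <= r by exact: enorm_ge0.
have dk2 : a * d k.+1 ^+ 2 <= K^-1 / 2.
  rewrite ltr_pdivlMr in dk1'; last by have := a_ge0; lra.
  have : d k.+1 * (4 * a) <= K^-1.
    by apply: ltW; apply: le_lt_trans dk1'; rewrite ler_wpM2l//; lra.
  have := ler_wpM2l (mulr_ge0 a_ge0 (d_ge0 k.+1)) (d_le2 k.+1).
  rewrite expr2; lra.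
have small1 : K * `|f (x k.+1) - fs| <= 1.
  rewrite -ler_pdivlMl// mulr1 fE// ler_norml.
  have := h_ge0 k.+1; have := mulr_ge0 a_ge0 (sqr_ge0 (d k.+1)).
  by move=> *; apply/andP; split; lra.
have small2 : K * r <= 1.
  rewrite -ler_pdivlMl// mulr1; apply: le_trans res _.
  move: dk dk1; rewrite !ltr_pdivlMr; try lra.
  by have := d_ge0 k; have := d_ge0 k.+1; lra.
have Px : suppmx (x N) *m x k.+1 = x k.+1 by rewrite -(suppE _ Nk1).1 suppmx_id.
have := hK _ (x_unit _) Px small1 small2; rewrite -/r.
set w := `|_ - _| => wl.
have hw : h k.+1 <= w + a * d k.+1 ^+ 2.
  by have := fE _ Nk1; have := ler_norm (f (x k.+1) - fs); rewrite -/w; lra.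
have w0 : 0 <= w by exact: normr_ge0.
have ad0 : 0 <= a * d k.+1 ^+ 2 by rewrite mulr_ge0 ?sqr_ge0.
apply: (@le_trans _ _ ((w + a * d k.+1 ^+ 2) ^+ 3)).
  by rewrite lerXn2r// nnegrE// addr_ge0.
apply: (@le_trans _ _ (4 * (w ^+ 3 + (a * d k.+1 ^+ 2) ^+ 3))).
  set u := a * _ in ad0 *; have := sqr_ge0 (w - u).
  by move=> /(ler_wpM2l (addr_ge0 w0 ad0)); lra.
have l1 : w ^+ 3 <= K * D ^+ 4 * (d k.+1 + d k) ^+ 4.
  apply: le_trans wl _; rewrite -mulrA ler_wpM2l ?(ltW K0)// -exprMn.
  by rewrite lerXn2r ?nnegrE// mulr_ge0// addr_ge0.
have l2 : (a * d k.+1 ^+ 2) ^+ 3 <= 4 * a ^+ 3 * (d k.+1 + d k) ^+ 4.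
  have -> : (a * d k.+1 ^+ 2) ^+ 3 = a ^+ 3 * (d k.+1 ^+ 2 * d k.+1 ^+ 4) by ring.
  have -> : 4 * a ^+ 3 * (d k.+1 + d k) ^+ 4 = a ^+ 3 * (2 ^+ 2 * (d k.+1 + d k) ^+ 4) by ring.
  rewrite ler_wpM2l ?exprn_ge0//; apply: ler_pM; rewrite ?exprn_ge0//.
    by rewrite lerXn2r ?nnegrE.
  by rewrite lerXn2r ?nnegrE ?addr_ge0// lerDl.
by rewrite /E; lra.
Qed.

Lemma gaps_summable : exists B, forall M, \sum_(0 <= k < M) d k <= B.
Proof.
have [E [N [E0 hE]]] := excess_loj.
exact: (finite_length d_ge0 h_ge0 delta_gt0 h_decrease E0 hE).
Qed.

Lemma iterates_cvg : exists xs : 'cV[R]_n, x @ \oo --> xs.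
Proof.
have [B hB] := gaps_summable; apply: (@finite_length_cvg _ _ _ B) => M.
apply: le_trans (hB M.+1); rewrite big_nat_recl//= ler_wpDl//.
Qed.

Section Limit.
Variable xs : 'cV[R]_n.
Hypothesis x_cvg : x @ \oo --> xs.

Let dist_cvg0 : (fun k => enorm (x k - xs)) @ \oo --> (0 : R).
Proof. exact/cvg_enormP. Qed.

Let gap_cvg0 : d @ \oo --> (0 : R).
Proof.
apply/cvgrPdist_lt => e e0; apply: filterS (d_cvg0 e0) => k.
by rewrite sub0r normrN ger0_norm.
Qed.

Lemma limit_unit : enorm xs = 1.
Proof.
have : (fun k => enorm (x k)) @ \oo --> enorm xs.
  exact: (cvg_comp _ _ x_cvg (@enorm_continuous _ _ xs)).
have -> : (fun k => enorm (x k)) = fun=> 1 by apply/funext => k; rewrite x_unit.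
move=> h; apply/esym; apply: cvg_unique h => //; exact: cvg_cst.
Qed.

(** Entries of the iterates that are not zero cannot tend to zero. *)
Let limit_zeros : \forall k \near \oo, same_zeros (x k) xs.
Proof.
have [kappa kappa0 hk] := entries.
have [e e0 he] := l0norm_near xs.
apply: near_oo_pred.
have m0 : 0 < Num.min e kappa by rewrite lt_min e0.
have /cvgrPdist_lt/(_ _ m0)[N _ hN] := dist_cvg0.
exists N => // k Nk i; have := hN k.+1 (leq_trans Nk (leqnSn _)).
rewrite /= sub0r normrN ger0_norm ?enorm_ge0// lt_min => /andP[h1 h2].
have [sub _] := he _ h1.
apply/idP/idP => [|/eqP xs0]; first by apply: contraTT; exact: sub.
apply/negPn/negP => /hk; apply/negP; rewrite -ltNge.
apply: le_lt_trans h2; have := coord_le_enorm (x k.+1 - xs) i.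
by rewrite !mxE xs0 subr0.
Qed.

(** The counting term is not continuous, but it is eventually constant along the
    sequence, so the variational inequalities of [prox_regP] pass to the limit. *)
Lemma limit_stationary : prox tau (reg lambda) (xs - tau *: G xs) xs.
Proof.
apply/(prox_regP _ tau_gt0 _ _ x0_unit); split; first exact: limit_unit.
move=> z z1.
have y_cvg : (fun k => xt k - tau *: G (xt k)) @ \oo --> xs - tau *: G xs.
  apply: (cvg_enorm_le (e := fun k => (1 + tau * L) * (bm * d k + enorm (x k - xs)))).
    rewrite -[X in _ --> X](_ : (1 + tau * L) * (bm * 0 + 0) = 0); last by ring.
    by apply: cvgM; [exact: cvg_cst|apply: cvgD => //; apply: cvgM => //; exact: cvg_cst].
  move=> k.
  have h1 : enorm (xt k - xs) <= bm * d k + enorm (x k - xs).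
    have -> : xt k - xs = (xt k - x k) + (x k - xs) by rewrite addrA subrK.
    apply: le_trans (enorm_triangle _ _) _; rewrite lerD2r xt_dist ler_wpM2r//.
    by have /andP[] := beta_range k.
  have -> : xt k - tau *: G (xt k) - (xs - tau *: G xs) =
     (xt k - xs) - tau *: (G (xt k) - G xs).
    by apply/colP => i; rewrite !mxE; ring.
  apply: le_trans (enorm_triangleB _ _) _; rewrite enormZ (gtr0_norm tau_gt0).
  have c0 : 0 <= 1 + tau * L by rewrite addr_ge0// mulr_ge0// ltW.
  apply: le_trans _ (ler_wpM2l c0 h1); rewrite mulrDl mul1r lerD2l -mulrA.
  by rewrite ler_wpM2l ?(ltW tau_gt0).
have xS_cvg : (fun k => x k.+1) @ \oo --> xs.
  by have := x_cvg; rewrite -(cvg_shiftS x).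
have lim_dot : (fun k => dotv (x k.+1 - z) (xt k - tau *: G (xt k))) @ \oo -->
    dotv (xs - z) (xs - tau *: G xs).
  by apply: cvg_dotv => //; apply: cvgB => //; exact: cvg_cst.
suff : lambda * tau * (l0norm xs)%:R - lambda * tau * (l0norm z)%:R <=
    dotv (xs - z) (xs - tau *: G xs) by rewrite dotvBl; lra.
rewrite -(cvg_lim (@Rhausdorff R) lim_dot); apply: limr_ge; first exact: cvgP lim_dot.
have [N _ hN] := limit_zeros; exists N => // k Nk /=.
have [_ <-] := same_suppmx (hN k.+1 (leq_trans Nk (leqnSn _))).
have /(prox_regP _ tau_gt0 _ _ x0_unit)[_ /(_ _ z1)] := x_step k.
rewrite -/(xt k) dotvBl; lra.
Qed.

(** The hypothesis is the inequality of exponent 1/2 at the limit, for points of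
    the sphere with the support of the limit.  Along the sequence it bounds the
    excess by the squares of the gaps, hence by a multiple of its decrease. *)
Lemma linear_rate (E e : R) : 0 <= E -> 0 < e ->
  (forall y, enorm y = 1 -> enorm (y - xs) < e -> l0norm y = l0norm xs ->
     f xs < f y -> f y < f xs + e ->
     f y - f xs <= E * enorm (tangent y (suppmx y *m G y)) ^+ 2) ->
  exists c1 rho : R, [/\ 0 < c1, 0 < rho < 1 &
    \forall k \near \oo, enorm (x k - xs) <= c1 * rho ^+ k].
Proof.
move=> E0 e0 kl.
pose fs := Hs - lambda * (l0norm xs)%:R.
have fE : \forall k \near \oo, f (x k) = fs + h k - a * d k ^+ 2.
  apply: filterS limit_zeros => k /same_suppmx[_ l0].
  by rewrite /h /H /Phi /fs l0; ring.
have fx_cvg : (fun k => f (x k)) @ \oo --> f xs.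
  apply/cvgrPdist_lt => eps eps0.
  pose c := enorm (G xs) + L / 2 + 1.
  have c0 : 0 < c by rewrite /c; have := enorm_ge0 (G xs); have := L_ge0; lra.
  have m0 : 0 < Num.min 1 (eps / c) by rewrite lt_min ltr01 divr_gt0.
  have /cvgrPdist_lt/(_ _ m0) := dist_cvg0; apply: filterS => k.
  rewrite sub0r normrN ger0_norm ?enorm_ge0// lt_min ltr_pdivlMr// => /andP[v1 ve].
  have v0 := enorm_ge0 (x k - xs).
  apply: le_lt_trans ve; rewrite distrC.
  have := f_taylor xs (x k - xs); rewrite [xs + _]addrC subrK => h1.
  have h2 := cauchy_schwarz (G xs) (x k - xs).
  rewrite -(subrK (dotv (G xs) (x k - xs)) (f (x k) - f xs)).
  apply: le_trans (ler_normD _ _) _.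
  have h3 : L / 2 * enorm (x k - xs) ^+ 2 <= L / 2 * enorm (x k - xs).
    by rewrite ler_wpM2l ?divr_ge0// expr2 ler_piMr// ltW.
  by rewrite /c; lra.
have fsE : f xs = fs.
  apply/eqP; rewrite -subr_eq0 -normr_le0; apply/ler_addgt0Pr => eps eps0.
  have e3 : 0 < eps / 3 by rewrite divr_gt0.
  have a3 : 0 < eps / 3 / (2 * a + 1) by rewrite divr_gt0//; have := a_ge0; lra.
  have /cvgrPdist_lt/(_ _ e3) := fx_cvg => F1.
  have := filterI F1 (filterI fE (filterI (h_cvg0 e3) (d_cvg0 a3))).
  move=> [N _ hN]; have /= [h1 [h2 [h3 h4]]] := hN N (leqnn N).
  rewrite ltr_pdivlMr in h4; last by have := a_ge0; lra.
  have h5 : a * d N ^+ 2 <= eps / 3.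
    have := ler_wpM2l (mulr_ge0 a_ge0 (d_ge0 N)) (d_le2 N); have := d_ge0 N.
    by rewrite expr2; lra.
  rewrite -(subrK (f (x N)) (f xs)) -addrA; apply: le_trans (ler_normD _ _) _.
  have -> : f (x N) - fs = h N - a * d N ^+ 2 by rewrite h2; ring.
  have h6 : `|h N - a * d N ^+ 2| <= eps / 3 + eps / 3.
    rewrite ler_norml; have := h_ge0 N; have := mulr_ge0 a_ge0 (sqr_ge0 (d N)).
    by move=> *; apply/andP; split; lra.
  lra.
pose D := (L + p) * (1 + bm).
have D0 : 0 <= D by rewrite mulr_ge0 ?addr_ge0 ?(ltW p_gt0).
pose q := (2 * E * D ^+ 2 + a + 1) / delta.
have ED : 0 <= 2 * E * D ^+ 2 by rewrite mulr_ge0 ?sqr_ge0// mulr_ge0.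
have q0 : 0 < q by rewrite divr_gt0//; have := a_ge0; lra.
have /cvgrPdist_lt/(_ _ e0) near_x := dist_cvg0.
have /cvgrPdist_lt/(_ _ e0) near_f := fx_cvg.
have [N _ hN] := filterI near_x (filterI near_f (filterI limit_zeros fE)).
have contr k : (N <= k)%N -> h k.+1 <= q * (h k - h k.+1).
  move=> Nk; have /= [h1 [h2 [h3 h4]]] := hN k.+1 (leq_trans Nk (leqnSn _)).
  have [_ l0] := same_suppmx h3.
  rewrite sub0r normrN ger0_norm ?enorm_ge0// in h1.
  have main : h k.+1 <= (2 * E * D ^+ 2 + a + 1) * (d k.+1 ^+ 2 + d k ^+ 2).
    have hE : h k.+1 = (f (x k.+1) - f xs) + a * d k.+1 ^+ 2 by rewrite h4 fsE; ring.
    have s1 := sqr_ge0 (d k.+1); have s0 := sqr_ge0 (d k).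
    have as0 := mulr_ge0 a_ge0 s0; have as1 := mulr_ge0 a_ge0 s1.
    have es := mulr_ge0 ED (addr_ge0 s1 s0).
    have [fle|flt] := leP (f (x k.+1)) (f xs); first by rewrite hE; lra.
    have fe : f (x k.+1) < f xs + e.
      by move: h2; rewrite distrC ltr_norml => /andP[_]; lra.
    have := kl _ (x_unit _) h1 l0 flt fe.
    have := residual k; rewrite -/D; set r := enorm _ => rD rk.
    have r2 : r ^+ 2 <= (D * (d k.+1 + d k)) ^+ 2.
      by rewrite lerXn2r ?nnegrE ?enorm_ge0// mulr_ge0// addr_ge0.
    have r3 : (D * (d k.+1 + d k)) ^+ 2 <= 2 * D ^+ 2 * (d k.+1 ^+ 2 + d k ^+ 2).
      have := mulr_ge0 (sqr_ge0 D) (sqr_ge0 (d k.+1 - d k)); lra.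
    have := ler_wpM2l E0 (le_trans r2 r3); rewrite hE; lra.
  apply: le_trans main _; rewrite /q [leRHS]mulrAC ler_pdivlMr// -[leLHS]mulrA ler_wpM2l//.
    by have := a_ge0; lra.
  by have := h_decrease k; lra.
have [c [rho [c0 rho01 hd]]] := geometric_decay d_ge0 h_ge0 delta_gt0 h_decrease q0 contr.
have [c1 c10 hc1] := geometric_rate c0 rho01 x_cvg hd.
by exists c1, rho.
Qed.

End Limit.

End Algorithm.

(** * Convergence and rate *)

Unset Implicit Arguments.

Theorem theorem4p1 (R : realType) (m n : nat) (A : 'M[R]_(m, n))
    (lambda sigma gamma : R)
    (lambda_gt0 : 0 < lambda)
    (sigma_gt0 : 0 < sigma) (sigma_le1 : sigma <= 1)
    (gamma_gt0 : 0 < gamma) (gamma_lt : gamma < sigma / 2)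
    (Lf : R) (Lf_def : Lf = lipschitz_const (grad (loss A sigma gamma)))
    (vsigma tau beta_max : R)
    (vsigma_gt0 : 0 < vsigma) (vsigma_lt1 : vsigma < 1)
    (tau_gt0 : 0 < tau)
    (tau_lt : (tau%:E < (1 - vsigma)%:E * (Lf%:E)^-1)%E)
    (beta_max_gt0 : 0 < beta_max)
    (beta_max_le : beta_max <=
       Num.sqrt (vsigma * (tau^-1 - Lf) * tau^-1) / (2 * (tau^-1 + Lf)))
    (beta : nat -> R)
    (beta_range : forall k, 0 <= beta k <= beta_max)
    (x : nat -> 'cV[R]_n)
    (x0_sphere : unit_sphere (x 0%N))
    (x_step : forall k, let xt := extrapolation beta x k in
       prox tau (reg lambda) (xt - tau *: grad (loss A sigma gamma) xt) (x k.+1)) :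
  (\sum_(1 <= k <oo) (enorm (x k.+1 - x k))%:E < +oo)%E /\
  exists xs : 'cV[R]_n,
    [/\ x @ \oo --> xs,
        tau_stationary A lambda sigma gamma tau xs &
        KL_function (objective A lambda sigma gamma) (1 / 2) ->
        exists c1 rho : R,
          [/\ 0 < c1, 0 < rho < 1 &
              \forall k \near \oo, enorm (x k - xs) <= c1 * rho ^+ k]].
Proof.
have [Lf_ge0 G_lip] := loss_lipschitz A gamma_gt0 gamma_lt.
have f_taylor := loss_descent A gamma_gt0 gamma_lt.
have f_loj := loss_lojasiewicz A gamma_gt0 gamma_lt.
rewrite -Lf_def in Lf_ge0 G_lip f_taylor.
have tauL : Lf < tau^-1.
  have [L0|L0] := eqVneq Lf 0; first by rewrite L0 invr_gt0.
  have Lp : 0 < Lf by rewrite lt_def L0.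
  move: tau_lt; rewrite inver (negPf L0) -EFinM lte_fin ltr_pdivlMr// => h.
  by rewrite -div1r ltr_pdivlMr// mulrC; lra.
have [B hB] := gaps_summable Lf_ge0 G_lip f_taylor f_loj lambda_gt0 tau_gt0
  vsigma_gt0 vsigma_lt1 tauL beta_max_le beta_range x0_sphere x_step.
have [xs x_cvg] := iterates_cvg Lf_ge0 G_lip f_taylor f_loj lambda_gt0 tau_gt0
  vsigma_gt0 vsigma_lt1 tauL beta_max_le beta_range x0_sphere x_step.
split.
  apply: (@le_lt_trans _ _ B%:E); last exact: ltry.
  apply: lime_le; first by apply: is_cvg_nneseries => k _ _; rewrite lee_fin enorm_ge0.
  apply: nearW => M; rewrite sumEFin lee_fin; apply: le_trans (hB M.+1).
  have gap0 k : 0 <= gap x k by exact: enorm_ge0.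
  rewrite big_nat_recl//; apply: ler_wpDl => //.
  case: M => [|M]; first by rewrite !big_geq.
  by rewrite [leRHS]big_ltn//; apply: ler_wpDl.
exists xs; split => //.
  exact: (limit_stationary Lf_ge0 G_lip f_taylor lambda_gt0 tau_gt0 vsigma_gt0
    vsigma_lt1 tauL beta_max_le beta_range x0_sphere x_step x_cvg).
move=> kl.
have xs1 : enorm xs = 1 := limit_unit tau_gt0 x0_sphere x_step x_cvg.
have L2 : 0 <= Lf / 2 by rewrite divr_ge0.
have sub := tangent_limiting_subgradient lambda_gt0 L2 f_taylor xs1.
have [E [e [E0 e0 hE]]] :=
  KL_half_quadratic lambda_gt0 L2 f_taylor xs1 (kl xs (ex_intro _ _ sub)).
exact: (linear_rate Lf_ge0 G_lip f_taylor lambda_gt0 tau_gt0 vsigma_gt0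
  vsigma_lt1 tauL beta_max_le beta_range x0_sphere x_step x_cvg E0 e0 hE).
Qed.
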